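(* Let $q_1,q_2$ be integers with $1\le q_1\le q_2$, $A=\begin{pmatrix}3q_1&0\\0&3q_2\end{pmatrix}$, $\mathcal{D}=\left\{\begin{pmatrix}0\\0\end{pmatrix},\begin{pmatrix}1\\0\end{pmatrix},\begin{pmatrix}0\\1\end{pmatrix}\right\}$, and $\mu_{A,\mathcal{D}}$ the associated Sierpiński-type measure. For any $t\in\left[0,\frac{\log3}{\log 3q_2}\right]$ there exist uncountably many spectra $\Lambda_t$ of $\mu_{A,\mathcal{D}}$ with $\dim_{Be}(\Lambda_t)=t$.
   Context: $\mu_{A,\mathcal{D}}$ is the unique Borel probability measure on $\mathbb{R}^2$ with $\mu_{A,\mathcal{D}}(E)=\frac13\sum_{d\in\mathcal{D}}\mu_{A,\mathcal{D}}(AE-d)$ for Borel $E$. A countable $\Lambda\subseteq\mathbb{R}^2$ is a spectrum of $\mu$ if $\{e^{-2\pi i\langle\lambda,x\rangle}:\lambda\in\Lambda\}$ is an orthonormal basis of $L^2(\mu)$. For countable $\Lambda\subseteq\mathbb{R}^d$ and $r>0$, $D_r^+(\Lambda)=\limsup_{h\to\infty}\sup_{x\in\mathbb{R}^d}\#(\Lambda\cap B(x,h))/h^r$ ($B(x,h)$ the open ball), and $\dim_{Be}(\Lambda)=\inf\{r:D_r^+(\Lambda)=0\}$. *)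

(* Defs.v *)
From HB Require Import structures.
From mathcomp Require Import all_boot all_order all_algebra.
From mathcomp Require Import finmap all_classical all_reals all_analysis.
Set Implicit Arguments. Unset Strict Implicit. Unset Printing Implicit Defensive.
Import Order.TTheory GRing.Theory Num.Theory.
Import numFieldNormedType.Exports.
Local Open Scope classical_set_scope.
Local Open Scope ring_scope.

Section Defs.
Variable R : realType.
Notation R2 := (R * R)%type.

Definition dot2 (l x : R2) : R := l.1 * x.1 + l.2 * x.2.

Definition affine_image (a1 a2 : R) (E : set R2) (d : R2) : set R2 :=
  [set (a1 * x.1 - d.1, a2 * x.2 - d.2) | x in E].

Definition sierpD : seq R2 := [:: (0, 0); (1, 0); (0, 1)].

Definition is_sierpinski_measure (q1 q2 : nat)
  (mu : probability R2 R) : Prop :=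
  forall E : set R2, measurable E ->
    (mu E = ((3%:R)^-1)%:E *
      \sum_(d <- sierpD) mu (affine_image (3 * q1%:R) (3 * q2%:R) E d))%E.

(* Lambda is a spectrum: the family e_lambda(x) = exp(-2 pi i <lambda,x>)
   is an orthonormal basis of L^2(mu) (complex valued).  Written out with
   real and imaginary parts: orthonormality (norm one is automatic since
   |e_lambda| = 1 and mu is a probability) and completeness (a function
   f = u + i v in L^2(mu) orthogonal to all e_lambda vanishes mu-a.e.). *)
Definition is_spectrum (mu : probability R2 R) (Lam : set R2) : Prop :=
  countable Lam /\
  (forall l l', Lam l -> Lam l' -> l <> l' ->
     (\int[mu]_x (cos (2 * pi * dot2 (l - l') x))%:E = 0)%E /\
     (\int[mu]_x (sin (2 * pi * dot2 (l - l') x))%:E = 0)%E) /\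
  (forall u v : R2 -> R,
     measurable_fun setT u -> measurable_fun setT v ->
     mu.-integrable setT (fun x => (u x ^+ 2)%:E) ->
     mu.-integrable setT (fun x => (v x ^+ 2)%:E) ->
     (forall l, Lam l ->
        (\int[mu]_x (u x * cos (2 * pi * dot2 l x)
                     - v x * sin (2 * pi * dot2 l x))%:E = 0)%E /\
        (\int[mu]_x (u x * sin (2 * pi * dot2 l x)
                     + v x * cos (2 * pi * dot2 l x))%:E = 0)%E) ->
     {ae mu, forall x, u x = 0 /\ v x = 0}).

Definition eball (x : R2) (h : R) : set R2 :=
  [set y | Num.sqrt ((y.1 - x.1) ^+ 2 + (y.2 - x.2) ^+ 2) < h].

Definition ecard (S : set R2) : \bar R :=
  if pselect (finite_set S) then ((size (enum_fset (fset_set S)))%:R)%:E else +oo%E.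

Definition sup_density (Lam : set R2) (r h : R) : \bar R :=
  ereal_sup [set (ecard (Lam `&` eball x h) * ((h `^ r)^-1)%:E)%E | x in setT].

Definition upper_beurling_density (Lam : set R2) (r : R) : \bar R :=
  ereal_inf [set ereal_sup [set sup_density Lam r h | h in [set h | M < h]]
            | M in [set M : R | 0 < M]].

Definition beurling_dim (Lam : set R2) : \bar R :=
  ereal_inf [set r%:E | r in [set r : R | 0 < r /\ upper_beurling_density Lam r = 0%E]].

End Defs.

(* Main.v *)
(* Let [m(x, y) = (1 + e(x) + e(y)) / 3], so that the transform of [mu] satisfies
   [mu^(l) = m(A^-1 l) mu^(A^-1 l)]. The candidate spectra are indexed by ternary
   words: [w] is sent to the expansion of its digits [0, 1, -1] in base [A] along the
   Hadamard direction [A (1/3, -1/3) = (q1, -q2)], plus a perturbation [sig w] of the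
   second coordinate that does not alter the lower digits. Distinct words are
   orthogonal since [m] vanishes at their lowest differing digit. For completeness,
   [|m|^2] sums to [1] over the three digits, so that the truncated products of
   [|mu^|^2] have a constant sum over the words of a given length; a uniform lower
   bound on [|mu^|^2] then gives Parseval's identity for indicators of cylinders,
   whose span is dense in [L^2(mu)].

   A word is good when its nonzero digits sit at positions of a set [J] of density
   [theta = t ln(3 q2) / ln 3]. Good words are not perturbed and produce the
   dimension [t]; each bad word is moved to a private scale [b^(level w)], so the
   bad words are lacunary and do not contribute to the dimension. The free bits
   [eps] in the levels yield uncountably many spectra. *)
Require Import Defs.
From mathcomp Require Import all_boot all_order all_algebra.
From mathcomp Require Import finmap all_classical all_reals all_analysis measurable_realfun.
From mathcomp Require Import zify ring lra.
Set Implicit Arguments. Unset Strict Implicit. Unset Printing Implicit Defensive.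
Import Order.TTheory GRing.Theory Num.Theory.
Import numFieldNormedType.Exports.
Local Open Scope classical_set_scope.
Local Open Scope ring_scope.

(** Completeness uses every ternary word, and the unperturbed words of length [M] already put [3^M]
    points in a ball of radius comparable to [b2^M], where [b2 = 3 q2]. A smaller dimension is
    therefore reached by displacing words, not by dropping them. A displacement must satisfy two
    constraints. Orthogonality requires that it respect residues modulo [b2^(n+1)] when a digit is
    put in front of a word of length [n]. Parseval requires that [|mu^|^2] stay bounded below at the
    matching scale, since otherwise mass escapes in the limit. Adding a single power [b2^M] is
    harmless for the second constraint: by periodicity of [m] it is invisible up to scale [M], and
    past that scale it only adds [1] to the second coordinate of [A^-M l], while [m] stays away from
    [0] as soon as the first coordinate alone is small. The density of [J] is chosen so that the
    good words of length [M] number about [3^(theta M) = (b2^M)^t]. Position [0] is kept out of [J],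
    so that bad words exist, and the free bits matter, even for the largest [t]. *)

(** * Expectations of bounded measurable and of integrable functions *)

Section Expectation.
Context d (T : measurableType d) (R : realType) (mu : probability T R).
Implicit Types f g : T -> R.

Definition bmeas f := measurable_fun setT f /\ exists M : R, forall x, `|f x| <= M.

Definition integ f := mu.-integrable setT (EFin \o f).

Definition Ex f : R := \int[mu]_x f x.

Lemma bmeas_integ f : bmeas f -> integ f.
Proof.
move=> [mf [M fM]]; apply: measurable_bounded_integrable => //.
  exact: (le_lt_trans (probability_le1 mu measurableT) (ltry 1)).
exists M; split; first exact: num_real.
by move=> y My x _; apply: (le_trans (fM x)); exact: ltW.
Qed.

Lemma integralEx f : integ f -> (\int[mu]_x (f x)%:E = (Ex f)%:E)%E.
Proof. by move=> fi; rewrite /Ex /Rintegral fineK//; exact: integrable_fin_num. Qed.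

Lemma eq_Ex f g : f =1 g -> Ex f = Ex g.
Proof. by move=> fg; apply: eq_Rintegral => x _; exact: fg. Qed.

Lemma integD f g : integ f -> integ g -> integ (fun x => f x + g x).
Proof. by move=> fi gi; exact: (integrableD measurableT fi gi). Qed.

Lemma integB f g : integ f -> integ g -> integ (fun x => f x - g x).
Proof. by move=> fi gi; exact: (integrableB measurableT fi gi). Qed.

Lemma integZ f c : integ f -> integ (fun x => c * f x).
Proof. by move=> fi; exact: (integrableZl measurableT c fi). Qed.

Lemma integ_sum (I : Type) (s : seq I) (F : I -> T -> R) :
  (forall i, integ (F i)) -> integ (fun x => \sum_(i <- s) F i x).
Proof.
move=> Fi; elim: s => [|i s IH].
  rewrite (_ : (fun x => _) = cst 0); first exact: integrable0.
  by apply/funext => x; rewrite big_nil.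
rewrite (_ : (fun x => _) = (fun x => F i x + \sum_(i <- s) F i x)); first exact: integD.
by apply/funext => x; rewrite big_cons.
Qed.

Lemma ExD f g : integ f -> integ g -> Ex (fun x => f x + g x) = Ex f + Ex g.
Proof. by move=> fi gi; exact: RintegralD. Qed.

Lemma ExB f g : integ f -> integ g -> Ex (fun x => f x - g x) = Ex f - Ex g.
Proof. by move=> fi gi; exact: RintegralB. Qed.

Lemma ExZ f c : integ f -> Ex (fun x => c * f x) = c * Ex f.
Proof. by move=> fi; exact: RintegralZl. Qed.

Lemma Ex_sum (I : Type) (s : seq I) (F : I -> T -> R) :
  (forall i, integ (F i)) ->
  Ex (fun x => \sum_(i <- s) F i x) = \sum_(i <- s) Ex (F i).
Proof.
move=> Fi; elim: s => [|i s IH].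
  rewrite big_nil (@eq_Ex _ (cst 0)); last by move=> x; rewrite big_nil.
  by rewrite /Ex Rintegral_cst// mul0r.
rewrite big_cons -IH -ExD//; last exact: integ_sum.
by apply: eq_Ex => x; rewrite big_cons.
Qed.

Lemma Ex_cst c : Ex (cst c) = c.
Proof.
rewrite /Ex Rintegral_cst//; have /= -> := probability_setT mu.
by rewrite mulr1.
Qed.

Lemma le_Ex f g : integ f -> integ g -> (forall x, f x <= g x) -> Ex f <= Ex g.
Proof. by move=> fi gi fg; exact: le_Rintegral. Qed.

Lemma ae_eq_Ex f g : measurable_fun setT f -> measurable_fun setT g ->
  {ae mu, forall x, f x = g x} -> Ex f = Ex g.
Proof.
move=> mf mg fg; rewrite /Ex /Rintegral; congr fine.
apply: ae_eq_integral => //; [exact/measurable_EFinP|exact/measurable_EFinP|].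
by apply: filterS fg => x /= ->.
Qed.

Lemma bmeas_cst c : bmeas (cst c).
Proof. by split => //; exists `|c|. Qed.

Lemma bmeasD f g : bmeas f -> bmeas g -> bmeas (fun x => f x + g x).
Proof.
move=> [mf [M fM]] [mg [N gN]]; split; first exact: measurable_funD.
exists (M + N) => x; apply: (le_trans (ler_normD _ _)); exact: lerD.
Qed.

Lemma bmeasM f g : bmeas f -> bmeas g -> bmeas (fun x => f x * g x).
Proof.
move=> [mf [M fM]] [mg [N gN]]; split; first exact: measurable_funM.
by exists (M * N) => x; rewrite normrM; apply: ler_pM.
Qed.

Lemma bmeasB f g : bmeas f -> bmeas g -> bmeas (fun x => f x - g x).
Proof.
move=> fb gb; rewrite (_ : (fun _ => _) = (fun x => f x + (cst (-1)) x * g x)).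
  by apply: bmeasD => //; apply: bmeasM => //; exact: bmeas_cst.
by apply/funext => x; rewrite /= mulN1r.
Qed.

Lemma bmeasZ f c : bmeas f -> bmeas (fun x => c * f x).
Proof. by move=> fb; apply: (@bmeasM (cst c)) => //; exact: bmeas_cst. Qed.

Lemma bmeas_sum (I : Type) (s : seq I) (F : I -> T -> R) :
  (forall i, bmeas (F i)) -> bmeas (fun x => \sum_(i <- s) F i x).
Proof.
move=> Fi; elim: s => [|i s IH].
  rewrite (_ : (fun x => _) = cst 0); first exact: bmeas_cst.
  by apply/funext => x; rewrite big_nil.
rewrite (_ : (fun x => _) = (fun x => F i x + \sum_(i <- s) F i x)); first exact: bmeasD.
by apply/funext => x; rewrite big_cons.
Qed.

Lemma bmeas_comp f (h : T -> T) : bmeas f -> measurable_fun setT h -> bmeas (f \o h).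
Proof.
move=> [mf [M fM]] mh; split; first exact: measurableT_comp.
by exists M => x; exact: fM.
Qed.

Lemma bmeas_cos f : measurable_fun setT f -> bmeas (fun x => cos (f x)).
Proof.
move=> mf; split; last by exists 1 => x; exact: cos_max.
by apply: measurableT_comp => //; apply: continuous_measurable_fun; exact: continuous_cos.
Qed.

Lemma bmeas_sin f : measurable_fun setT f -> bmeas (fun x => sin (f x)).
Proof.
move=> mf; split; last by exists 1 => x; exact: sin_max.
by apply: measurableT_comp => //; apply: continuous_measurable_fun; exact: continuous_sin.
Qed.

Lemma bmeas_indic (A : set T) : measurable A -> bmeas (\1_A : T -> R).
Proof.
move=> mA; split; first exact: measurable_indic.
by exists 1 => x; rewrite indicE; case: (x \in A); rewrite ?normr1 ?normr0.
Qed.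

Lemma integM f g : integ f -> bmeas g -> integ (fun x => f x * g x).
Proof.
move=> fi [mg [M gM]].
have mf : measurable_fun setT f by apply/measurable_EFinP; exact: measurable_int fi.
apply: (@le_integrable _ _ _ mu setT measurableT _ (EFin \o (fun x => M * f x))).
- by apply/measurable_EFinP; exact: measurable_funM.
- move=> x _ /=; rewrite lee_fin !normrM mulrC ler_wpM2r//.
  exact: (le_trans (gM x) (ler_norm _)).
- exact: integZ.
Qed.

End Expectation.
Arguments bmeas_cst {d T R} c.

(** * Self-similarity of the measure, as a statement about pushforwards *)

Section SelfSimilar.
Context (R : realType).
Implicit Types (d : 'I_3) (l x : R * R).

Definition dg1 d : R := (d == 1 :> nat)%:R.
Definition dg2 d : R := (d == 2 :> nat)%:R.

Definition simil (b1 b2 : R) d x : R * R := ((x.1 + dg1 d) / b1, (x.2 + dg2 d) / b2).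

Lemma measurable_simil b1 b2 d : measurable_fun setT (simil b1 b2 d).
Proof.
by apply: measurable_fun_pair; apply: measurable_funM => //; apply: measurable_funD.
Qed.

(** [simil d] is the inverse of [x |-> A x - d], so the sets [A E - d] of the invariance equation
    become preimages, that is, pushforwards of [mu]. *)
Lemma affine_image_simil (b1 b2 : R) (E : set (R * R)) d : b1 != 0 -> b2 != 0 ->
  affine_image b1 b2 E (dg1 d, dg2 d) = simil b1 b2 d @^-1` E.
Proof.
move=> b10 b20; apply/seteqP; split => [_ [x Ex <-]|x Ex]; rewrite /simil/=.
  rewrite !subrK -!(mulrC (_ ^-1)) !mulrA !mulVf// !mul1r.
  by case: x Ex.
exists (simil b1 b2 d x) => //; rewrite /simil/= -!(mulrC (_ ^-1)) !mulrA !mulfV// !mul1r !addrK.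
by case: x Ex.
Qed.

Variables (q1 q2 : nat) (hq1 : (1 <= q1)%N) (hq2 : (1 <= q2)%N).
Variable mu : probability (R * R)%type R.
Hypothesis hmu : is_sierpinski_measure q1 q2 mu.
Let b1 : R := 3 * q1%:R.
Let b2 : R := 3 * q2%:R.

Lemma sierpinski_simil (E : set (R * R)) : measurable E ->
  (mu E = (3^-1)%:E * \sum_(d < 3) mu (simil b1 b2 d @^-1` E))%E.
Proof.
move=> mE; rewrite (hmu mE); congr (_ * _)%E.
have b10 : b1 != 0 by rewrite mulf_neq0 ?pnatr_eq0// -lt0n.
have b20 : b2 != 0 by rewrite mulf_neq0 ?pnatr_eq0// -lt0n.
rewrite !big_ord_recl big_ord0 -!affine_image_simil//.
by rewrite /sierpD !big_cons big_nil.
Qed.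

Let push d : {measure set (R * R) -> \bar R} :=
  measure_function_pushforward__canonical__measure_function_Measure mu
    (measurable_simil b1 b2 d).

Lemma ge0_integral_simil (f : R * R -> \bar R) : measurable_fun setT f ->
  (forall x, 0 <= f x)%E ->
  (\int[mu]_x f x = (3^-1)%:E * \sum_(d < 3) \int[mu]_x f (simil b1 b2 d x))%E.
Proof.
move=> mf f0.
have i3 : 0 <= 3^-1 :> R by rewrite invr_ge0.
(* [mu] agrees with this average of three pushforwards on measurable sets; [msum] is indexed by
   [nat], whence [inord]. *)
pose m := mscale (NngNum i3) (msum (fun n => push (inord n)) 3).
rewrite (eq_measure_integral m); last first.
  move=> A mA _; apply: (eq_trans (sierpinski_simil mA)); rewrite /m /mscale /= /msum; congr (_ * _)%E.
  by apply: eq_bigr => d _; rewrite inord_val.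
rewrite /m ge0_integral_mscale//=; congr (_ * _)%E.
rewrite ge0_integral_measure_sum//; apply: eq_bigr => d _.
rewrite inord_val ge0_integral_pushforward ?preimage_setT//.
exact: measurable_simil.
Qed.

(** Adding the bound [M] to [f] reduces this to the nonnegative case. *)
Lemma Ex_simil (f : R * R -> R) : bmeas f ->
  Ex mu f = 3^-1 * \sum_(d < 3) Ex mu (fun x => f (simil b1 b2 d x)).
Proof.
move=> [mf [M fM]].
have fb : bmeas f by split => //; exists M.
have f0 x : 0 <= f x + M by have := fM x; rewrite ler_norml => /andP[]; lra.
have gb : bmeas (fun x => f x + M) by apply: bmeasD => //; exact: bmeas_cst.
have mg : measurable_fun setT (fun x => (f x + M)%:E).
  by apply/measurable_EFinP; case: gb.
have := @ge0_integral_simil (fun x => (f x + M)%:E) mg (fun x => f0 x).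
have -> : (\int[mu]_x (f x + M)%:E = (Ex mu f + M)%:E)%E.
  rewrite integralEx; last exact: bmeas_integ.
  rewrite ExD ?(Ex_cst mu M)//; first exact: bmeas_integ.
  by apply: bmeas_integ; exact: bmeas_cst.
under eq_bigr => d _.
  rewrite integralEx; last first.
    by apply: bmeas_integ; exact: (bmeas_comp gb (measurable_simil b1 b2 d)).
  rewrite ExD ?(Ex_cst mu M)//; last 2 first.
  - by apply: bmeas_integ; exact: (bmeas_comp fb (measurable_simil b1 b2 d)).
  - by apply: bmeas_integ; exact: bmeas_cst.
  over.
rewrite sumEFin -EFinM => -[].
rewrite big_split/= sumr_const card_ord mulrDr => H.
apply: (addIr M); rewrite H; congr (_ + _).
by rewrite -[M *+ 3]mulr_natr mulrCA mulVf ?mulr1 ?pnatr_eq0.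
Qed.

End SelfSimilar.

(** * The trigonometric polynomial [|m|^2] *)

Section Mask.
Context (R : realType).
Implicit Types x y s : R.

Lemma pi_le4 : pi <= 4 :> R.
Proof. by have [/andP[_]] := @pihalf_02_cos_pihalf R; rewrite ler_pdivrMr//; lra. Qed.

Lemma sin_le_id s : 0 <= s -> sin s <= s.
Proof.
move=> s0; have [c _ H] := @MVT_segment R sin cos 0 s s0
  (fun x _ => is_derive_sin x) (continuous_subspaceT (@continuous_sin R)).
by move: H; rewrite sin0 !subr0 => ->; rewrite -[leRHS]mul1r ler_wpM2r// cos_le1.
Qed.

Lemma sin2_le s : sin s ^+ 2 <= s ^+ 2.
Proof.
wlog s0 : s / 0 <= s.
  move=> H; have [/H//|/ltW s0] := lerP 0 s.
  by have := H (- s); rewrite sinN !sqrrN; apply; lra.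
rewrite -[leLHS]real_normK ?num_real// lerXn2r ?nnegrE// ler_norml sin_le_id// andbT.
have [s1|s1] := lerP 1 s; first by apply: le_trans (sin_geN1 s); lra.
have : 0 <= sin s by apply: sin_ge0_pi; rewrite s0/=; have := @pi_ge2 R; lra.
by lra.
Qed.

Lemma cos_ge_quad s : 1 - s ^+ 2 / 2 <= cos s.
Proof.
have -> : s = (s / 2) *+ 2 by rewrite -mulr_natr mulfVK ?pnatr_eq0.
rewrite cos_mulr2n cos2sin2; have := sin2_le (s / 2).
rewrite -[(s/2) *+ 2]mulr_natr exprMn; lra.
Qed.

(** With [c = cos (pi / 3)], the triple angle formula turns [cos pi = -1] into
    [(c + 1) (2 c - 1)^2 = 0], and [c = -1] is excluded because [sin (pi / 3) > 0]. *)
Lemma cos_2pi3 : cos (2 * pi / 3) = - 2^-1 :> R.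
Proof.
set a : R := pi / 3.
have pi0 := @pi_gt0 R.
have sa : 0 < sin a by apply: sin_gt0_pi; rewrite /a; lra.
have ca := cos2Dsin2 a.
have : cos (3 * a) = -1 by rewrite /a mulrC mulfVK ?pnatr_eq0// cospi.
have -> : 3 * a = a *+ 2 + a by rewrite -mulr_natr; lra.
rewrite cosD cos_mulr2n sin_mulr2n => H3.
have -> : 2 * pi / 3 = a *+ 2 by rewrite -mulr_natr /a; lra.
rewrite cos_mulr2n.
have s2 : sin a ^+ 2 = 1 - cos a ^+ 2 by lra.
have : (cos a + 1) * (2 * cos a - 1) ^+ 2 = 0.
  have H4 : cos a * sin a *+ 2 * sin a = 2 * cos a * (1 - cos a ^+ 2).
    by rewrite -s2; ring.
  rewrite H4 in H3.
  transitivity ((cos a ^+ 2 *+ 2 - 1) * cos a - 2 * cos a * (1 - cos a ^+ 2) + 1); first by ring.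
  by rewrite H3 addNr.
move=> /eqP; rewrite mulf_eq0 sqrf_eq0 => /orP[] /eqP c1.
  have : sin a ^+ 2 = 0 by rewrite s2 (_ : cos a = -1); [ring|lra].
  by move=> /eqP; rewrite sqrf_eq0 => /eqP; lra.
have -> : cos a = 2^-1 by lra.
by rewrite -mulr_natr; field.
Qed.

Lemma cos_pi3 : cos (pi / 3) = 2^-1 :> R.
Proof.
have -> : pi / 3 = pi - 2 * pi / 3 :> R by field.
by rewrite addrC -[_ + pi]opprK cosN opprD opprK -cosN opprB cosB cospi sinpi cos_2pi3; lra.
Qed.

(* [|1 + e(x) + e(y)|^2 / 9] with [e(s) = exp(2 i pi s)]. *)
Definition mask x y : R :=
  ((1 + cos (2 * pi * x) + cos (2 * pi * y)) ^+ 2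
   + (sin (2 * pi * x) + sin (2 * pi * y)) ^+ 2) / 9.

Lemma maskE x y : mask x y =
  (3 + 2 * cos (2 * pi * x) + 2 * cos (2 * pi * y) + 2 * cos (2 * pi * x - 2 * pi * y)) / 9.
Proof.
rewrite /mask cosB; set a := 2 * pi * x; set b := 2 * pi * y.
have := cos2Dsin2 a; have := cos2Dsin2 b => Hb Ha; congr (_ / _).
have -> : (1 + cos a + cos b) ^+ 2 + (sin a + sin b) ^+ 2 =
  1 + (cos a ^+ 2 + sin a ^+ 2) + (cos b ^+ 2 + sin b ^+ 2) + 2 * cos a + 2 * cos b
  + 2 * (cos a * cos b + sin a * sin b) by ring.
by rewrite Ha Hb; ring.
Qed.

Lemma mask_ge0 x y : 0 <= mask x y.
Proof. by rewrite /mask divr_ge0// addr_ge0// sqr_ge0. Qed.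

Lemma mask_le1 x y : mask x y <= 1.
Proof.
rewrite maskE ler_pdivrMr// mul1r; have := cos_le1 (2 * pi * x).
have := cos_le1 (2 * pi * y); have := cos_le1 (2 * pi * x - 2 * pi * y); lra.
Qed.

Lemma mask00 : mask 0 0 = 1.
Proof. by rewrite /mask !mulr0 cos0 sin0; field. Qed.

Lemma cos_int x (m : int) : cos (2 * pi * (x + m%:~R)) = cos (2 * pi * x).
Proof.
have nat_case (n : nat) y : cos (2 * pi * (y + n%:R)) = cos (2 * pi * y).
  rewrite mulrDr -(periodicn (@cosD2pi R) n (2 * pi * y)); congr cos.
  by rewrite -[pi *+ 2 *+ n]mulr_natr -[pi *+ 2]mulr_natl.
case: m => n; first exact: nat_case.
by rewrite NegzE mulrNz -[in RHS](subrK (n.+1%:R) x) nat_case.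
Qed.

Lemma sin_int x (m : int) : sin (2 * pi * (x + m%:~R)) = sin (2 * pi * x).
Proof.
have nat_case (n : nat) y : sin (2 * pi * (y + n%:R)) = sin (2 * pi * y).
  rewrite mulrDr -(periodicn (@sinD2pi R) n (2 * pi * y)); congr sin.
  by rewrite -[pi *+ 2 *+ n]mulr_natr -[pi *+ 2]mulr_natl.
case: m => n; first exact: nat_case.
by rewrite NegzE mulrNz -[in RHS](subrK (n.+1%:R) x) nat_case.
Qed.

Lemma mask_int x y (m n : int) : mask (x + m%:~R) (y + n%:~R) = mask x y.
Proof. by rewrite /mask !cos_int !sin_int. Qed.

(** Unitarity of the 3 x 3 Fourier matrix: under the three shifts each of the cross terms [e(x)],
    [e(y)], [e(x - y)] is multiplied by the three cube roots of unity, hence sums to [0]. *)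
Lemma mask_sum x y : mask x y + mask (x + 3^-1) (y - 3^-1) + mask (x - 3^-1) (y + 3^-1) = 1.
Proof.
rewrite !maskE.
have c4 : cos ((2 * pi / 3) *+ 2) = - 2^-1 :> R by rewrite cos_mulr2n cos_2pi3; field.
have E1 z : 2 * pi * (z + 3^-1) = 2 * pi * z + 2 * pi / 3 by ring.
have E2 z : 2 * pi * (z - 3^-1) = 2 * pi * z - 2 * pi / 3 by ring.
rewrite !E1 !E2.
set a := 2 * pi * x; set b := 2 * pi * y; set e := 2 * pi / 3.
have -> : a + e - (b - e) = (a - b) + e *+ 2 by rewrite -mulr_natr; ring.
have -> : a - e - (b + e) = (a - b) - e *+ 2 by rewrite -mulr_natr; ring.
rewrite !(cosD _ e) !(cosB _ e) !(cosD _ (e *+ 2)) !(cosB _ (e *+ 2)) c4 cos_2pi3.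
by field.
Qed.

Lemma mask_third : mask 3^-1 (- 3^-1) = 0 /\ mask (- 3^-1) 3^-1 = 0.
Proof.
have := mask_sum 0 0; rewrite mask00 !add0r => H.
by have := mask_ge0 3^-1 (- 3^-1); have := mask_ge0 (- 3^-1) 3^-1; split; lra.
Qed.

(* The modulus of [1 + e(x)] is at least [sqrt 3] when [|x| <= 1/6], so adding
   the unit vector [e(y)] cannot bring it near [0]. *)
Lemma mask_low x y : `|x| <= 6^-1 -> 20^-1 <= mask x y.
Proof.
move=> hx; rewrite maskE.
have pi0 := @pi_gt0 R.
set a := 2 * pi * x; set b := 2 * pi * y.
have ca : 2^-1 <= cos a.
  have na : `|a| <= pi / 3.
    rewrite normrM ger0_norm; last by lra.
    have : 2 * pi * `|x| <= 2 * pi * 6^-1 by apply: ler_wpM2l => //; lra.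
    by lra.
  have h1 : `|a| \in `[0, pi] by rewrite in_itv/= normr_ge0/=; lra.
  have h2 : pi / 3 \in `[0, pi : R] by rewrite in_itv/=; lra.
  by rewrite -cos_norm -cos_pi3 leNgt (ltr_cos h2 h1) -leNgt.
set u := cos (a / 2).
have cu : cos a = u ^+ 2 *+ 2 - 1.
  by rewrite -cos_mulr2n -[a / 2 *+ 2]mulr_natr mulfVK ?pnatr_eq0.
have -> : b = a / 2 + (b - a / 2) by lra.
rewrite (_ : a - _ = a / 2 - (b - a / 2)); last by lra.
set v := b - a / 2; rewrite (cosD (a / 2) v) (cosB (a / 2) v) -/u.
have u2 : 3 / 4 <= u ^+ 2 by rewrite -[u ^+ 2 *+ 2]mulr_natr in cu; lra.
have uv : - `|u| <= u * cos v.
  rewrite -[leRHS]opprK lerN2; apply: (le_trans (ler_norm _)).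
  by rewrite normrN normrM -[leRHS]mulr1 ler_wpM2l// cos_max.
have u8 : 86 / 100 <= `|u|.
  rewrite leNgt; apply/negP => h; have : `|u| ^+ 2 < (86/100) ^+ 2.
    by rewrite ltrXn2r ?nnegrE.
  by rewrite real_normK ?num_real// => h2; lra.
have nu2 : `|u| ^+ 2 = u ^+ 2 by rewrite real_normK ?num_real.
rewrite cu -nu2 -[ `|u| ^+ 2 *+ 2]mulr_natr ler_pdivlMr//.
(* With [w = |u|], nine times the mask is [1 + 4 w^2 + 4 u cos v], which is at least
   [(2 w - 1)^2]. *)
suff : 9/20 <= (2 * `|u| - 1) ^+ 2.
  by move: uv; set w := `|u|; set z := u * cos v; set z' := sin _ * sin _; lra.
by nra.
Qed.

End Mask.

(** * The measure is carried by the square [[0, 1/2]^2] *)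

Section Support.
Context (R : realType) (q1 q2 : nat) (hq1 : (1 <= q1)%N) (hq2 : (1 <= q2)%N).
Variable mu : probability (R * R)%type R.
Hypothesis hmu : is_sierpinski_measure q1 q2 mu.
Let b1 : R := 3 * q1%:R.
Let b2 : R := 3 * q2%:R.
Notation S := (simil b1 b2).

(* Self-similarity gives [mu {phi > s} <= mu {phi > 3 s}], and the right-hand side
   iterates to [0]. *)
Lemma contracted_le0 (phi : R * R -> R) : measurable_fun setT phi ->
  (forall d x, 0 < phi (S d x) -> 3 * phi (S d x) <= phi x) ->
  {ae mu, forall x, phi x <= 0}.
Proof.
move=> mphi hphi.
pose F (t : R) := [set x | t < phi x].
have mF t : measurable (F t).
  rewrite -[F t]setTI; have := mphi measurableT `]t, +oo[%classic (measurable_itv _).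
  by congr (measurable _); apply/seteqP; split => x /=; rewrite in_itv/= andbT.
have step t : 0 < t -> (mu (F t) <= mu (F (3 * t)%R))%E.
  move=> t0; rewrite (sierpinski_simil hq1 hq2 hmu (mF t)).
  have H d : (mu (S d @^-1` F t) <= mu (F (3 * t)%R))%E.
    apply: le_measure; rewrite ?inE//.
      by rewrite -[X in measurable X]setTI; exact: measurable_simil.
    move=> x /=; rewrite /F /= => tx; have : 3 * phi (S d x) <= phi x by apply: hphi; lra.
    by lra.
  apply: (@le_trans _ _ ((3^-1)%:E * \sum_(d < 3) mu (F (3 * t)%R))%E).
    by apply: lee_wpmul2l; [rewrite lee_fin invr_ge0|apply: lee_sum].
  have fF : mu (F (3 * t)%R) \is a fin_num by exact: fin_num_measure.
  rewrite -(fineK fF) sumEFin -EFinM lee_fin sumr_const card_ord.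
  by rewrite -[fine _ *+ 3]mulr_natr mulrCA mulVf ?pnatr_eq0// mulr1.
have F0 t : 0 < t -> mu (F t) = 0%E.
  move=> t0.
  have iter n : (mu (F t) <= mu (F (3 ^+ n * t)%R))%E.
    elim: n => [|n IH]; first by rewrite expr0 mul1r.
    by apply: (le_trans IH); rewrite exprS -mulrA; apply: step; rewrite mulr_gt0// exprn_gt0.
  have cv : (fun n => mu (F (3 ^+ n * t)%R)) @ \oo --> mu (\bigcap_n F (3 ^+ n * t)).
    apply: nonincreasing_cvg_mu => //.
    - exact: (le_lt_trans (probability_le1 mu (mF _)) (ltry 1)).
    - by apply: bigcap_measurable => // n _; exact: mF.
    - move=> m n mn; apply/subsetPset => x; rewrite /F /=; apply: le_lt_trans.
      by rewrite ler_wpM2r ?(ltW t0)// ler_eXn2l// ltr1n.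
  have E0 : \bigcap_n F (3 ^+ n * t) = set0.
    apply/seteqP; split => // x hx.
    have [n hn] : exists n : nat, phi x / t < n%:R.
      by exists (Num.bound `|phi x / t|); apply: (le_lt_trans (ler_norm _)); exact: archi_boundP.
    have := hx n I; rewrite /F /= => h.
    have : phi x < n%:R * t by rewrite -ltr_pdivrMr.
    have : n%:R <= 3 ^+ n :> R by rewrite -natrX ler_nat ltnW// ltn_expl.
    by move=> h1 h2; have := ler_wpM2r (ltW t0) h1; lra.
  rewrite E0 measure0 in cv.
  apply/eqP; rewrite eq_le measure_ge0 andbT.
  apply: (@cvge_to_ge _ _ _ _ _ _ _ cv) => //.
  by apply: nearW => n; exact: iter.
have : {ae mu, forall x, forall k, phi x <= k.+1%:R^-1}.
  apply: ae_foralln => k; exists (F (k.+1%:R^-1)); split => //; first by apply: F0; rewrite invr_gt0.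
  by move=> x /= /negP; rewrite -ltNge.
apply: filterS => x hx; rewrite leNgt; apply/negP => p0.
have := hx (Num.bound (phi x)^-1); rewrite leNgt => /negP; apply.
rewrite invf_plt ?posrE//.
have := @archi_boundP R (phi x)^-1; rewrite invr_ge0 => /(_ (ltW p0)) h.
by apply: (lt_le_trans h); rewrite ler_nat.
Qed.

(** The side [1/2] is the fixed point of [y |-> (y + 1) / 3], the least contracting case [q = 1]. *)
Definition quarter (x : R * R) : Prop := [/\ 0 <= x.1, x.1 <= 2^-1, 0 <= x.2 & x.2 <= 2^-1].

Lemma ratio_ge3 (q : nat) : (1 <= q)%N -> 3 <= 3 * q%:R :> R.
Proof. by move=> h; rewrite -[leLHS]mulr1 ler_pM2l// ler1n. Qed.

(** Each of the four excesses [- x.1], [- x.2], [x.1 - 1/2], [x.2 - 1/2], when positive after a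
    similarity, was at least three times larger before it, so [contracted_le0] applies. *)
Lemma ae_quarter : {ae mu, forall x, quarter x}.
Proof.
have B1 : 3 <= b1 by exact: ratio_ge3.
have B2 : 3 <= b2 by exact: ratio_ge3.
have low (b y e : R) : 3 <= b -> 0 <= e -> 0 < - ((y + e) / b) -> 3 * - ((y + e) / b) <= - y.
  move=> hb he; set z := - _ => hz.
  have -> : y = - (b * z) - e by rewrite /z mulrN opprK mulrC mulfVK ?addrK//; lra.
  have : 3 * z <= b * z by rewrite ler_wpM2r// ltW.
  by lra.
have up (b y e : R) : 3 <= b -> e <= 1 -> 0 < (y + e) / b - 2^-1 ->
    3 * ((y + e) / b - 2^-1) <= y - 2^-1.
  move=> hb he; set z := _ - 2^-1 => hz.
  have -> : y = b * (z + 2^-1) - e by rewrite /z subrK mulrC mulfVK ?addrK//; lra.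
  have : 3 * (z + 2^-1) <= b * (z + 2^-1) by rewrite ler_wpM2r//; lra.
  by lra.
have dle (d : 'I_3) : [/\ 0 <= dg1 R d, dg1 R d <= 1, 0 <= dg2 R d & dg2 R d <= 1].
  by rewrite /dg1 /dg2 !ler0n !lern1; split => //; case: eqP.
have h1 : {ae mu, forall x, - x.1 <= 0}.
  apply: contracted_le0 => [|d x]; first by apply: measurableT_comp => //.
  by case: (dle d) => *; exact: low.
have h2 : {ae mu, forall x, - x.2 <= 0}.
  apply: contracted_le0 => [|d x]; first by apply: measurableT_comp => //.
  by case: (dle d) => *; exact: low.
have h3 : {ae mu, forall x, x.1 - 2^-1 <= 0}.
  apply: contracted_le0 => [|d x]; first by apply: measurable_funB => //.
  by case: (dle d) => *; exact: up.
have h4 : {ae mu, forall x, x.2 - 2^-1 <= 0}.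
  apply: contracted_le0 => [|d x]; first by apply: measurable_funB => //.
  by case: (dle d) => *; exact: up.
apply: filterS2 (filterI h1 h2) (filterI h3 h4) => x [? ?] [? ?]; split; lra.
Qed.

End Support.

(** * The Fourier transform of the measure and of its restrictions to cylinders *)

Section Fourier.
Context (R : realType) (q1 q2 : nat) (hq1 : (1 <= q1)%N) (hq2 : (1 <= q2)%N).
Variable mu : probability (R * R)%type R.
Implicit Types (l x : R * R) (d : 'I_3) (h : R * R -> R).

Definition ang l x : R := 2 * pi * dot2 l x.

Lemma measurable_ang l : measurable_fun setT (ang l).
Proof. by apply: measurable_funM => //; apply: measurable_funD; apply: measurable_funM. Qed.

Lemma bmeas_cos_ang l : bmeas (fun x => cos (ang l x)).
Proof. by apply: bmeas_cos; exact: measurable_ang. Qed.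

Lemma bmeas_sin_ang l : bmeas (fun x => sin (ang l x)).
Proof. by apply: bmeas_sin; exact: measurable_ang. Qed.

Definition FC l := Ex mu (fun x => cos (ang l x)).
Definition FS l := Ex mu (fun x => sin (ang l x)).
(* The squared modulus of the Fourier transform of [mu]. *)
Definition power l := FC l ^+ 2 + FS l ^+ 2.

Lemma power_ge0 l : 0 <= power l.
Proof. by rewrite addr_ge0// sqr_ge0. Qed.

(** The variance of the character, [1 - power l], is nonnegative. *)
Lemma power_le1 l : power l <= 1.
Proof.
pose f x := (cos (ang l x) - FC l) ^+ 2 + (sin (ang l x) - FS l) ^+ 2.
have fE : f =1 (fun x => (1 + power l) - (2 * FC l * cos (ang l x) + 2 * FS l * sin (ang l x))).
  by move=> x; rewrite /f /power; have := cos2Dsin2 (ang l x); lra.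
have f0 : 0 <= Ex mu f by apply: Rintegral_ge0 => x _; rewrite /f addr_ge0// sqr_ge0.
have ic := bmeas_integ mu (bmeas_cos_ang l).
have is_ := bmeas_integ mu (bmeas_sin_ang l).
move: f0; rewrite (eq_Ex mu fE) ExB; last 2 first.
- by apply: bmeas_integ; exact: bmeas_cst.
- by apply: integD; exact: integZ.
rewrite (Ex_cst mu (1 + power l)) ExD ?ExZ//; last 2 first.
- exact: integZ.
- exact: integZ.
rewrite -/(FC l) -/(FS l) /power; lra.
Qed.

Lemma Ex_rotate h l c : bmeas h ->
  Ex mu (fun x => h x * cos (ang l x + c)) =
    cos c * Ex mu (fun x => h x * cos (ang l x)) - sin c * Ex mu (fun x => h x * sin (ang l x))
  /\ Ex mu (fun x => h x * sin (ang l x + c)) =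
    cos c * Ex mu (fun x => h x * sin (ang l x)) + sin c * Ex mu (fun x => h x * cos (ang l x)).
Proof.
move=> hb.
have ic : integ mu (fun x => h x * cos (ang l x)).
  by apply: bmeas_integ; apply: bmeasM => //; exact: bmeas_cos_ang.
have is_ : integ mu (fun x => h x * sin (ang l x)).
  by apply: bmeas_integ; apply: bmeasM => //; exact: bmeas_sin_ang.
split.
  rewrite -!ExZ// -ExB; [|exact: integZ..].
  by apply: eq_Ex => x; rewrite cosD; ring.
rewrite -!ExZ// -ExD; [|exact: integZ..].
by apply: eq_Ex => x; rewrite sinD; ring.
Qed.

Hypothesis hmu : is_sierpinski_measure q1 q2 mu.
Let b1 : R := 3 * q1%:R.
Let b2 : R := 3 * q2%:R.
Notation S := (simil b1 b2).

Definition dilate n l : R * R := (l.1 / b1 ^+ n, l.2 / b2 ^+ n).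

Lemma dilateD m n l : dilate m (dilate n l) = dilate (n + m) l.
Proof. by rewrite /dilate/= !exprD !invfM !mulrA. Qed.

Lemma dilate0 l : dilate 0 l = l.
Proof. by rewrite /dilate !expr0 !divr1; case: l. Qed.

Lemma ang_simil l d x :
  ang l (S d x) = ang (dilate 1 l) x + ang (dilate 1 l) (dg1 R d, dg2 R d).
Proof. by rewrite /ang /dot2 /simil /dilate/= !expr1; ring. Qed.

Lemma power_rec l : power l = mask (dilate 1 l).1 (dilate 1 l).2 * power (dilate 1 l).
Proof.
set l' := dilate 1 l.
have H1 (f : R * R -> R) : Ex mu (fun x => cst 1 x * f x) = Ex mu f.
  by apply: eq_Ex => x; rewrite mul1r.
have rot c := @Ex_rotate (cst 1) l' c (bmeas_cst _).
have rot1 c : Ex mu (fun x => cos (ang l' x + c)) = cos c * FC l' - sin c * FS l'.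
  rewrite -H1 (rot c).1; congr (_ * _ - _ * _); exact: H1.
have rot2 c : Ex mu (fun x => sin (ang l' x + c)) = cos c * FS l' + sin c * FC l'.
  rewrite -H1 (rot c).2; congr (_ * _ + _ * _); exact: H1.
have E1 : FC l = 3^-1 * \sum_(d < 3) (cos (ang l' (dg1 R d, dg2 R d)) * FC l'
                            - sin (ang l' (dg1 R d, dg2 R d)) * FS l').
  rewrite {1}/FC (Ex_simil hq1 hq2 hmu (bmeas_cos_ang l)); congr (_ * _).
  by apply: eq_bigr => d _; rewrite -rot1; apply: eq_Ex => x; rewrite ang_simil.
have E2 : FS l = 3^-1 * \sum_(d < 3) (cos (ang l' (dg1 R d, dg2 R d)) * FS l'
                            + sin (ang l' (dg1 R d, dg2 R d)) * FC l').
  rewrite {1}/FS (Ex_simil hq1 hq2 hmu (bmeas_sin_ang l)); congr (_ * _).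
  by apply: eq_bigr => d _; rewrite -rot2; apply: eq_Ex => x; rewrite ang_simil.
rewrite /power E1 E2 /mask !big_ord_recl !big_ord0 /dg1 /dg2 /ang /dot2 /=.
rewrite !mulr0 !mulr1 !addr0 !add0r !mulr0 cos0 sin0; by field.
Qed.

Lemma power_dilate_le n l : power l <= power (dilate n l).
Proof.
elim: n => [|n IH]; first by rewrite dilate0.
apply: (le_trans IH); rewrite power_rec dilateD addn1.
by rewrite -[leRHS]mul1r ler_wpM2r ?power_ge0 ?mask_le1.
Qed.

(** A zero of the mask at a single scale kills the whole transform; orthogonality is read off from
    this. *)
Lemma power_le_mask n l : power l <= mask (dilate n.+1 l).1 (dilate n.+1 l).2.
Proof.
apply: (le_trans (power_dilate_le n l)); rewrite power_rec dilateD addn1.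
by rewrite -[leRHS]mulr1 ler_wpM2l ?mask_ge0 ?power_le1.
Qed.

(** On the square, [|ang l x| <= 2 pi s / 2 <= 4 s], so the cosine is at least [1 - 8 s^2]; squaring
    the resulting bound on [FC] gives the [16]. *)
Lemma power_near0 l : 1 - 16 * (`|l.1| + `|l.2|) ^+ 2 <= power l.
Proof.
set s := `|l.1| + `|l.2|.
have h : 1 - 8 * s ^+ 2 <= FC l.
  rewrite /FC -(Ex_cst mu (1 - 8 * s ^+ 2)).
  (* The bound on the cosine holds only almost everywhere, while [le_Ex] asks for it at every point;
     the maximum repairs this without changing the expectation. *)
  rewrite (@ae_eq_Ex _ _ _ _ (fun x => cos (ang l x)) (fun x => Num.max (cos (ang l x)) (1 - 8 * s ^+ 2))).
  - apply: le_Ex; [by apply: bmeas_integ; exact: bmeas_cst| |by move=> x; rewrite le_max lexx orbT].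
    apply: bmeas_integ; split; last first.
      exists (1 + `|1 - 8 * s ^+ 2|) => x.
      have := cos_max (ang l x) => h; rewrite /Num.max; case: ifP => _; first by lra.
      by apply: (le_trans h); rewrite lerDl.
    by apply: measurable_maxr => //; case: (bmeas_cos_ang l).
  - by case: (bmeas_cos_ang l).
  - by apply: measurable_maxr => //; case: (bmeas_cos_ang l).
  - apply: filterS (ae_quarter hq1 hq2 hmu) => x [x1 x2 x3 x4].
    rewrite max_l//; apply: le_trans (cos_ge_quad _).
    have : `|ang l x| <= 4 * s.
      rewrite /ang normrM ger0_norm; last by rewrite mulr_ge0// pi_ge0.
      have : `|dot2 l x| <= s / 2.
        apply: (le_trans (ler_normD _ _)); rewrite !normrM (ger0_norm x1) (ger0_norm x3) /s mulrDl.
        by apply: lerD; apply: ler_wpM2l.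
      move=> h; apply: (@le_trans _ _ (2 * pi * (s / 2))).
        by apply: ler_wpM2l => //; rewrite mulr_ge0// pi_ge0.
      have s0 : 0 <= s by rewrite addr_ge0.
      by have := ler_wpM2r s0 (pi_le4 R); lra.
    move=> h; have : `|ang l x| ^+ 2 <= (4 * s) ^+ 2 by rewrite lerXn2r ?nnegrE// (le_trans _ h).
    by rewrite real_normK ?num_real// exprMn; lra.
have := power_ge0 l; have := sqr_ge0 (FS l); have := sqr_ge0 (FC l); rewrite /power.
set a := 8 * s ^+ 2 in h => h1 h2 h3.
rewrite (_ : 16 * s ^+ 2 = 2 * a); last by rewrite /a; ring.
have [h4|h4] := lerP 1 (2 * a); first by lra.
nra.
Qed.

(* [dig] and [shift] invert the similarities on the square [0, 1/2]^2, which carries [mu]. *)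
Definition dig x : 'I_3 :=
  if 1 <= b1 * x.1 then inord 1 else if 1 <= b2 * x.2 then inord 2 else ord0.

Definition shift x : R * R := (b1 * x.1 - dg1 R (dig x), b2 * x.2 - dg2 R (dig x)).

Fixpoint cyl (u : seq 'I_3) : set (R * R) :=
  if u is d :: u' then [set x | dig x = d /\ cyl u' (shift x)] else setT.

Lemma b1_neq0 : b1 != 0. Proof. by rewrite mulf_neq0 ?pnatr_eq0// -lt0n. Qed.
Lemma b2_neq0 : b2 != 0. Proof. by rewrite mulf_neq0 ?pnatr_eq0// -lt0n. Qed.

Lemma dig_simil d x : quarter x -> dig (S d x) = d.
Proof.
move=> [x1 x2 x3 x4]; rewrite /dig /simil/= ![_ * (_ / _)]mulrC !mulfVK ?b1_neq0 ?b2_neq0//.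
have lt1 (y : R) : y <= 2^-1 -> (1 <= y) = false by move=> ?; apply/negbTE; rewrite -ltNge; lra.
have ge1 (y : R) : 0 <= y -> (1 <= y + 1) by move=> ?; lra.
case: d => -[|[|[|//]]] hd; rewrite /dg1 /dg2/=; apply: val_inj => /=.
- by rewrite !addr0 !lt1.
- by rewrite ge1// inordK.
- by rewrite addr0 lt1// ge1// inordK.
Qed.

Lemma shift_simil d x : quarter x -> shift (S d x) = x.
Proof.
move=> hx; rewrite /shift dig_simil// /simil/= ![_ * (_ / _)]mulrC !mulfVK ?b1_neq0 ?b2_neq0//.
by rewrite !addrK; case: x hx.
Qed.

Lemma measurable_dig d : measurable [set x | dig x = d].
Proof.
have m1 : measurable [set x : R * R | 1 <= b1 * x.1].
  rewrite -[X in measurable X]setTI; apply: measurable_fun_le => //.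
  by apply: measurable_funM.
have m2 : measurable [set x : R * R | 1 <= b2 * x.2].
  rewrite -[X in measurable X]setTI; apply: measurable_fun_le => //.
  by apply: measurable_funM.
have mC (A : set (R * R)) : measurable A -> measurable (~` A) by exact: measurableC.
case: d => -[|[|[|//]]] hd.
- rewrite (_ : [set _ | _] = ~` [set x : R * R | 1 <= b1 * x.1] `&` ~` [set x : R * R | 1 <= b2 * x.2]).
    by apply: measurableI; exact: mC.
  apply/seteqP; split => x /=; rewrite /dig.
    by case: ifP => [_ /(congr1 val)/=|_]; [rewrite inordK|case: ifP => // _ /(congr1 val)/=; rewrite inordK].
  by move=> [/negP/negbTE -> /negP/negbTE ->]; apply: val_inj.
- rewrite (_ : [set _ | _] = [set x : R * R | 1 <= b1 * x.1])//.
  apply/seteqP; split => x /=; rewrite /dig.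
    by case: ifP => // _; case: ifP => _ /(congr1 val)/=; rewrite ?inordK.
  by move=> ->; apply: val_inj => /=; rewrite inordK.
- rewrite (_ : [set _ | _] = ~` [set x : R * R | 1 <= b1 * x.1] `&` [set x : R * R | 1 <= b2 * x.2]).
    by apply: measurableI => //; exact: mC.
  apply/seteqP; split => x /=; rewrite /dig.
    by case: ifP => [_ /(congr1 val)/=|_]; [rewrite inordK|case: ifP => // _ /(congr1 val)/=; rewrite inordK].
  by move=> [/negP/negbTE -> ->]; apply: val_inj => /=; rewrite inordK.
Qed.

Lemma measurable_digfun (g : 'I_3 -> R) : measurable_fun setT (fun x => g (dig x)).
Proof.
rewrite (_ : (fun x => _) = (fun x => \sum_(d < 3) g d * \1_[set y | dig y = d] x)).
  apply: measurable_sum => d; apply: measurable_funM => //.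
  by apply: measurable_indic; exact: measurable_dig.
apply/funext => x; rewrite (bigD1 (dig x))//= indicE mem_set// mulr1 big1 ?addr0// => d hd.
by rewrite indicE memNset ?mulr0//= => e; rewrite e eqxx in hd.
Qed.

Lemma measurable_shift : measurable_fun setT shift.
Proof.
by apply: measurable_fun_pair; apply: measurable_funB;
  [apply: measurable_funM|exact: measurable_digfun|apply: measurable_funM|exact: measurable_digfun].
Qed.

Lemma measurable_cyl u : measurable (cyl u).
Proof.
elim: u => [|d u IH] /=; first exact: measurableT.
apply: (@measurableI _ _ [set x | dig x = d] [set x | cyl u (shift x)]).
  exact: measurable_dig.
by rewrite -[X in measurable X]setTI; exact: measurable_shift.
Qed.

(** In the self-similar expansion only the branch [d] survives, since [simil d'] sends almost every
    point to one with first digit [d']. *)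
Lemma Ex_cyl_cons d u (g : R * R -> R) : bmeas g ->
  Ex mu (fun x => \1_(cyl (d :: u)) x * g x) =
  3^-1 * Ex mu (fun x => \1_(cyl u) x * g (S d x)).
Proof.
move=> gb; have ib v := bmeas_indic R (measurable_cyl v).
have fb v : bmeas (fun x => \1_(cyl v) x * g x) by apply: bmeasM.
rewrite (Ex_simil hq1 hq2 hmu (fb (d :: u))) (bigD1 d)//= [X in _ + X]big1 ?addr0; last first.
  move=> d' dd'; rewrite -[RHS](Ex_cst mu 0); apply: ae_eq_Ex => //.
    by case: (bmeas_comp (fb (d :: u)) (measurable_simil b1 b2 d')).
  apply: filterS (ae_quarter hq1 hq2 hmu) => x hx.
  rewrite indicE memNset ?mul0r//= dig_simil//; case => e.
  by rewrite e eqxx in dd'.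
congr (_ * _); apply: ae_eq_Ex.
- by case: (bmeas_comp (fb (d :: u)) (measurable_simil b1 b2 d)).
- apply: measurable_funM; first by case: (ib u).
  by case: (bmeas_comp gb (measurable_simil b1 b2 d)).
apply: filterS (ae_quarter hq1 hq2 hmu) => x hx; congr (_ * _).
rewrite !indicE; congr (_%:R); congr (nat_of_bool _); apply/idP/idP; rewrite !inE/= dig_simil// shift_simil//.
by case.
Qed.

Lemma Ex_cyl u : Ex mu (\1_(cyl u)) = (3 ^+ size u)^-1.
Proof.
have E v : Ex mu (\1_(cyl v)) = Ex mu (fun x => \1_(cyl v) x * (cst 1 x)).
  by apply: eq_Ex => x; rewrite mulr1.
elim: u => [|d u IH].
  rewrite /= expr0 invr1 -[RHS](Ex_cst mu 1); apply: eq_Ex => x.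
  by rewrite indicE in_setT.
rewrite E (Ex_cyl_cons d u (bmeas_cst 1)).
by rewrite -[X in 3^-1 * X]/(Ex mu (fun x => \1_(cyl u) x * cst 1 x)) -E IH -invfM -exprS.
Qed.

(** The restriction of [mu] to a cylinder of length [n] is [3^-n] times an affine copy of [mu]; the
    translation only contributes a phase, which the squared modulus forgets. *)
Lemma power_cyl u l :
  Ex mu (fun x => \1_(cyl u) x * cos (ang l x)) ^+ 2
  + Ex mu (fun x => \1_(cyl u) x * sin (ang l x)) ^+ 2 =
  (9 ^+ size u)^-1 * power (dilate (size u) l).
Proof.
elim: u l => [|d u IH] l.
  rewrite expr0 invr1 mul1r dilate0 /power /FC /FS.
  congr (_ ^+ 2 + _ ^+ 2); apply: eq_Ex => x; rewrite indicE in_setT mul1r//.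
rewrite (Ex_cyl_cons d u (bmeas_cos_ang l)) (Ex_cyl_cons d u (bmeas_sin_ang l)).
have E1 : Ex mu (fun x => \1_(cyl u) x * cos (ang l (S d x))) =
   Ex mu (fun x => \1_(cyl u) x * cos (ang (dilate 1 l) x + ang (dilate 1 l) (dg1 R d, dg2 R d))).
  by apply: eq_Ex => x; rewrite ang_simil.
have E2 : Ex mu (fun x => \1_(cyl u) x * sin (ang l (S d x))) =
   Ex mu (fun x => \1_(cyl u) x * sin (ang (dilate 1 l) x + ang (dilate 1 l) (dg1 R d, dg2 R d))).
  by apply: eq_Ex => x; rewrite ang_simil.
have [] := Ex_rotate (dilate 1 l) (ang (dilate 1 l) (dg1 R d, dg2 R d))
   (bmeas_indic R (measurable_cyl u)).
rewrite -E1 -E2 => -> ->.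
have := IH (dilate 1 l); rewrite dilateD add1n /=.
have := cos2Dsin2 (ang (dilate 1 l) (dg1 R d, dg2 R d)).
set a := Ex mu _; set b := Ex mu _; set c := cos _; set s := sin _ => cs ab.
rewrite [9 ^+ _.+1]exprS invfM -mulrA -ab.
transitivity (9^-1 * ((c ^+ 2 + s ^+ 2) * (a ^+ 2 + b ^+ 2))); first by field.
by rewrite cs mul1r.
Qed.

End Fourier.

(** * Ternary words and their values in balanced digits *)

Section Words.

Fixpoint words n : seq (seq 'I_3) :=
  if n is n'.+1 then [seq d :: w | d <- enum 'I_3, w <- words n'] else [:: [::]].

Lemma mem_words n w : (w \in words n) = (size w == n).
Proof.
elim: n w => [|n IH] [|d w] //=; rewrite ?inE//.
  by apply/negbTE/negP => /allpairsP[[d w] /= [_ _]].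
rewrite eqSS -IH; apply/allpairsP/idP => [[[d' w'] /= [_ h [_ ->]]]//|h].
by exists (d, w); rewrite mem_enum.
Qed.

Lemma uniq_words n : uniq (words n).
Proof.
elim: n => [|n IH] //=; apply: allpairs_uniq => //; first exact: enum_uniq.
by move=> [d w] [d' w'] _ _ /= [-> ->].
Qed.

Lemma size_words n : size (words n) = (3 ^ n)%N.
Proof. by elim: n => [|n IH] //=; rewrite size_allpairs size_enum_ord IH expnS. Qed.

Lemma sum_words (R : pzSemiRingType) n (F : seq 'I_3 -> R) :
  \sum_(w <- words n.+1) F w = \sum_(d < 3) \sum_(w <- words n) F (d :: w).
Proof. by rewrite /= big_allpairs_dep big_enum. Qed.

(** Balanced digits keep [q * val3 (3 * q) w] within half of [(3 q)^n], which the bounds on the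
    frequencies rely on. *)
Definition tau (d : 'I_3) : int := if d == 1 :> nat then 1 else if d == 2 :> nat then -1 else 0.

(* The head of a word is its most significant digit. *)
Fixpoint val3 (b : nat) (w : seq 'I_3) : int :=
  if w is d :: w' then tau d * (b%:Z) ^+ size w' + val3 b w' else 0.

Lemma tau_bound d : `|tau d| <= 1.
Proof. by case: d => -[|[|[|//]]]. Qed.

(** The geometric sum [(b - 1) (1 + ... + b^(n-1)) = b^n - 1], written without division. *)
Lemma val3_bound b w : (1 <= b)%N -> (b%:Z - 1) * `|val3 b w| + 1 <= (b%:Z) ^+ size w.
Proof.
move=> b1; elim: w => [|d w IH]; first by rewrite /= normr0 mulr0 add0r expr0.
rewrite /= exprS; move: IH; set B := b%:Z ^+ size w => IH.
have h : `|tau d * B + val3 b w| <= B + `|val3 b w|.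
  apply: (le_trans (ler_normD _ _)); rewrite lerD2r normrM [X in _ * X]ger0_norm ?exprn_ge0//.
  by rewrite -[leRHS]mul1r ler_wpM2r ?exprn_ge0// tau_bound.
have b0 : 0 <= b%:Z - 1 by lia.
by have := ler_wpM2l b0 h; lia.
Qed.

(** For base [3 q] the geometric bound suffices because [2 q <= 3 q - 1]. *)
Lemma qval3_half q w : (1 <= q)%N -> 2 * `|q%:Z * val3 (3 * q) w| <= (3 * q)%N%:Z ^+ size w.
Proof.
move=> hq; have := @val3_bound (3 * q) w; rewrite muln_gt0 hq => /(_ isT).
by rewrite normrM; have := normr_ge0 (val3 (3 * q) w); nia.
Qed.

Lemma val3_consr (R : pzRingType) b d w :
  (val3 b (d :: w))%:~R = (tau d)%:~R * b%:R ^+ size w + (val3 b w)%:~R :> R.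
Proof. by rewrite /= rmorphD rmorphM rmorphXn. Qed.

Lemma mod_eq_diff (R : pzRingType) m n D : (m = n %[mod D])%N ->
  exists k : int, m%:R = n%:R + k%:~R * D%:R :> R.
Proof.
move=> h; exists ((m %/ D)%N%:Z - (n %/ D)%N%:Z).
rewrite {1}(divn_eq m D) {1}(divn_eq n D) h !natrD !natrM rmorphB mulrBl/=.
by rewrite [RHS]addrC addrA subrK.
Qed.

End Words.

(** * The candidate frequencies: orthogonality, lower bound and Parseval sums *)

Section Frequencies.
Context (R : realType) (q1 q2 : nat) (hq1 : (1 <= q1)%N) (hq2 : (1 <= q2)%N).
Variable sig : seq 'I_3 -> nat.
Let B1 := (3 * q1)%N.
Let B2 := (3 * q2)%N.

Definition lam1 w : int := q1%:Z * val3 B1 w.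
Definition lam2 w : int := (sig w)%:Z - q2%:Z * val3 B2 w.
Definition lam w : R * R := ((lam1 w)%:~R, (lam2 w)%:~R).

(** What is asked of the perturbation: the congruence protects the lower digits, invariance under a
    leading [0] lets words be padded to a common length, and the shape of the values yields the
    lower bound [power_lam_low]. *)
Hypothesis sig_mod : forall d w, (sig (d :: w) = sig w %[mod B2 ^ (size w).+1])%N.
Hypothesis sig0 : forall w, sig (ord0 :: w) = sig w.
Hypothesis sig_form : forall w, exists2 r, (r < B2 ^ size w)%N &
  sig w = r \/ exists M, sig w = (r + B2 ^ M)%N.

Lemma lam0 w : lam (ord0 :: w) = lam w.
Proof. by rewrite /lam /lam1 /lam2 sig0 /= /tau /= !mul0r !add0r. Qed.

Let b1 : R := 3 * q1%:R.
Let b2 : R := 3 * q2%:R.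
Notation dil := (dilate (R := R) q1 q2).

Let B1E : B1%:R = b1. Proof. by rewrite natrM. Qed.
Let B2E : B2%:R = b2. Proof. by rewrite natrM. Qed.

(** A new leading digit adds [tau d] times [A^(n+1) (1/3, -1/3)], up to a multiple of [b2^(n+1)].
    Hence it is an integer shift at scales up to [n] and a shift by [(tau d / 3, - tau d / 3)]
    modulo integers at scale [n + 1]. *)
Lemma lam_cons d w : exists k : int, lam (d :: w) =
  ((lam w).1 + q1%:R * (tau d)%:~R * b1 ^+ size w,
   (lam w).2 - q2%:R * (tau d)%:~R * b2 ^+ size w + k%:~R * b2 ^+ (size w).+1).
Proof.
have [k hk] := mod_eq_diff R (sig_mod d w); exists k.
rewrite /lam /lam1 /lam2 !intrB !intrM !val3_consr B1E B2E /fst /snd; congr (_, _).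
  by rewrite -[(q1%:Z)%:~R]/(q1%:R : R); ring.
rewrite -[((sig (d :: w))%:Z)%:~R]/((sig (d :: w))%:R : R) hk natrX B2E.
rewrite -[(q2%:Z)%:~R]/(q2%:R : R) -[((sig w)%:Z)%:~R]/((sig w)%:R : R); ring.
Qed.

Let b1n0 : b1 != 0. Proof. by rewrite mulf_neq0 ?pnatr_eq0// -lt0n. Qed.
Let b2n0 : b2 != 0. Proof. by rewrite mulf_neq0 ?pnatr_eq0// -lt0n. Qed.

Lemma dilate_lam_low d w j : (j <= size w)%N -> exists m n : int,
  dil j (lam (d :: w)) = ((dil j (lam w)).1 + m%:~R, (dil j (lam w)).2 + n%:~R).
Proof.
move=> jw; have [k hk] := lam_cons d w.
exists (q1%:Z * tau d * (B1 ^ (size w - j))%N%:Z).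
exists (k * (B2 ^ (size w - j).+1)%N%:Z - q2%:Z * tau d * (B2 ^ (size w - j))%N%:Z).
have n1 : b1 ^+ j != 0 by rewrite expf_neq0.
have n2 : b2 ^+ j != 0 by rewrite expf_neq0.
have P1 n : ((B1 ^ n)%N%:Z)%:~R = b1 ^+ n by rewrite -B1E -natrX.
have P2 n : ((B2 ^ n)%N%:Z)%:~R = b2 ^+ n by rewrite -B2E -natrX.
rewrite hk /dilate /= -/b1 -/b2 !intrB !intrM !P1 !P2.
rewrite -[in LHS](subnK jw) !exprS !exprD.
rewrite -[(q1%:Z)%:~R]/(q1%:R : R) -[(q2%:Z)%:~R]/(q2%:R : R); congr (_, _); by field.
Qed.

Lemma dilate_lam_top d w : exists k : int,
  dil (size w).+1 (lam (d :: w)) =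
  ((dil (size w).+1 (lam w)).1 + (tau d)%:~R / 3,
   (dil (size w).+1 (lam w)).2 - (tau d)%:~R / 3 + k%:~R).
Proof.
have [k hk] := lam_cons d w; exists k.
have n1 : b1 ^+ size w != 0 by rewrite expf_neq0.
have n2 : b2 ^+ size w != 0 by rewrite expf_neq0.
have m1 : q1%:R != 0 :> R by rewrite pnatr_eq0 -lt0n.
have m2 : q2%:R != 0 :> R by rewrite pnatr_eq0 -lt0n.
rewrite hk /dilate /= -/b1 -/b2 !exprS; congr (_, _).
  by set X := b1 ^+ size w in n1 *; rewrite /b1; field; rewrite n1 m1.
by set X := b2 ^+ size w in n2 *; rewrite /b2; field; rewrite n2 m2.
Qed.

(** The difference of two distinct digits is [1], [-1], [2] or [-2], and [2/3] agrees with [-1/3]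
    modulo integers. *)
Lemma mask_tau d d' : d != d' ->
  mask ((tau d - tau d')%:~R / 3 : R) (- ((tau d - tau d')%:~R / 3)) = 0.
Proof.
have [t1 t2] := mask_third R.
have two : mask (2 / 3 : R) (- (2 / 3)) = 0.
  by rewrite -(mask_int _ _ (-1) 1) -[RHS]t2; congr mask; rewrite ?mulrN1z ?mulr1z; field.
have mtwo : mask (- (2 / 3) : R) (2 / 3) = 0.
  by rewrite -(mask_int _ _ 1 (-1)) -[RHS]t1; congr mask; rewrite ?mulrN1z ?mulr1z; field.
have one : mask (1 / 3 : R) (- (1 / 3)) = 0 by rewrite mul1r.
have mone : mask (- (1 / 3) : R) (1 / 3) = 0 by rewrite mul1r.
case: d => -[|[|[|//]]] ?; case: d' => -[|[|[|//]]] ?; rewrite /tau //= => _;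
  rewrite ?intrB ?mulrN1z ?mulr0z ?mulr1z ?sub0r ?subr0 ?opprK ?mulNr ?opprK //.
by rewrite -[RHS]mtwo; congr mask; field.
Qed.

Definition maskp (l : R * R) := mask l.1 l.2.

(** The infinite product for [power (dil n l)] cut after [m] factors; see [power_mprod]. *)
Definition mprod n m l := \prod_(j < m) maskp (dil (n + j).+1 l).

Lemma mprod_ge0 n m l : 0 <= mprod n m l.
Proof. by apply: prodr_ge0 => j _; exact: mask_ge0. Qed.

Lemma mprod_le1 n m l : mprod n m l <= 1.
Proof.
suff /andP[] : 0 <= mprod n m l <= 1 by [].
rewrite /mprod; elim/big_ind: _ => [|x y /andP[x0 x1] /andP[y0 y1]|j _].
- by rewrite ler01 lexx.
- by rewrite mulr_ge0// mulr_ile1.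
- by rewrite mask_ge0 mask_le1.
Qed.

(** The leading digit affects only the last factor, whose three values sum to [1] by [mask_sum];
    with no factor left, the sum counts the [3^n] words. *)
Lemma sum_mprod n m : \sum_(w <- words (n + m)) mprod n m (lam w) = 3 ^+ n.
Proof.
elim: m => [|m IH].
  rewrite addn0; under eq_bigr do rewrite /mprod big_ord0.
  by rewrite big_const_seq count_predT size_words iter_addr_0 -natrX.
rewrite addnS sum_words exchange_big/= -IH big_seq [RHS]big_seq; apply: eq_bigr => w.
rewrite mem_words => /eqP sw.
have low d : mprod n m (lam (d :: w)) = mprod n m (lam w).
  apply: eq_bigr => j _; have [|i1 [i2 ->]] := @dilate_lam_low d w (n + j).+1.
    by rewrite sw -addnS leq_add2l.
  by rewrite /maskp /= mask_int.
under eq_bigr => d _.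
  rewrite /mprod big_ord_recr/= -/(mprod n m _) low -sw; over.
rewrite -mulr_sumr -[RHS]mulr1; congr (_ * _).
rewrite !big_ord_recl big_ord0 addr0.
have top d : maskp (dil (size w).+1 (lam (d :: w))) =
  mask ((dil (size w).+1 (lam w)).1 + (tau d)%:~R / 3) ((dil (size w).+1 (lam w)).2 - (tau d)%:~R / 3).
  have [k ->] := dilate_lam_top d w; rewrite /maskp /=.
  by rewrite -[X in mask X _]addr0 -[0]/(0%:~R) mask_int.
rewrite !top /tau /= !mul0r !subr0 !addr0 mulrN1z !mul1r mulN1r opprK addrA.
exact: mask_sum.
Qed.

(** The head being most significant, the recursion follows the tails as long as they differ; once
    they agree, the two heads differ and [mask_tau] applies at that scale. *)
Lemma orth_digit w w' : size w = size w' -> w != w' ->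
  exists2 v, (v < size w)%N & maskp (dil v.+1 (lam w - lam w')) = 0.
Proof.
elim: w w' => [|d w IH] [|d' w'] //= [sw] ww'.
have [e|ne] := eqVneq w w'; last first.
  have [v vw hv] := IH _ sw ne; exists v; first exact: ltnW.
  have [|m [n e1]] := @dilate_lam_low d w v.+1; first by [].
  have [|m' [n' e2]] := @dilate_lam_low d' w' v.+1; first by rewrite -sw.
  have dB l l' : dil v.+1 (l - l') = dil v.+1 l - dil v.+1 l' by rewrite /dilate /= !mulrBl.
  rewrite dB e1 e2 /maskp /= -hv /maskp dB /=.
  rewrite -[RHS](mask_int _ _ (m - m') (n - n')) !rmorphB /=; congr mask.
    ring.
  ring.
subst w'; exists (size w) => //.
have [k ek] := dilate_lam_top d w; have [k' ek'] := dilate_lam_top d' w.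
have dB l l' : dil (size w).+1 (l - l') = dil (size w).+1 l - dil (size w).+1 l'.
  by rewrite /dilate /= !mulrBl.
rewrite dB ek ek' /maskp /=.
have key := mask_tau (contra_neq (fun e => congr1 (cons^~ w) e) ww').
by rewrite -key -[RHS](mask_int _ _ 0 (k - k')) !rmorphB/=; congr mask; ring.
Qed.

Variable mu : probability (R * R)%type R.
Hypothesis hmu : is_sierpinski_measure q1 q2 mu.
Notation power := (power mu).

Lemma power_orth w w' : size w = size w' -> w != w' -> power (lam w - lam w') = 0.
Proof.
move=> sw ww'; have [v _ hv] := orth_digit sw ww'.
apply/eqP; rewrite eq_le power_ge0 andbT -[leRHS]hv.
exact: (power_le_mask hq1 hq2 hmu).
Qed.

Lemma power_mprod n m l : power (dil n l) = mprod n m l * power (dil (n + m) l).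
Proof.
elim: m => [|m IH]; first by rewrite /mprod big_ord0 mul1r addn0.
rewrite IH (power_rec hq1 hq2 hmu) dilateD addn1 mulrA /mprod big_ord_recr/=.
by rewrite -addnS.
Qed.

Let b1_3 : 3 <= b1. Proof. exact: ratio_ge3. Qed.
Let b2_3 : 3 <= b2. Proof. exact: ratio_ge3. Qed.

Lemma dilate_small (b y : R) n : 3 <= b -> `|y / b ^+ n| <= `|y| / 3 ^+ n.
Proof.
move=> hb; rewrite normrM ler_wpM2l// ger0_norm ?invr_ge0 ?exprn_ge0//; last by lra.
by rewrite lef_pV2 ?posrE ?exprn_gt0//; [rewrite lerXn2r ?nnegrE; lra|lra].
Qed.

(** Four factors [1/20] from [mask_low] and a remainder [1/2] from [power_near0]; see
    [power_box]. *)
Definition c0 : R := 20^-1 ^+ 4 / 2.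

Lemma c0_gt0 : 0 < c0. Proof. by rewrite /c0 divr_gt0// exprn_gt0// invr_gt0. Qed.

(** [mask_low] constrains only the first coordinate, so the second one may range up to [3] and
    absorb the perturbation. Four dilations bring the point within [(1/2 + 3) / 81 < 1/20] of the
    origin. *)
Lemma power_box x y : `|x| <= 2^-1 -> `|y| <= 3 -> c0 <= power (x, y).
Proof.
move=> hx hy; rewrite -[(x, y)](dilate0 q1 q2) (power_mprod 0 4) add0n.
have h1 : 20^-1 ^+ 4 <= mprod 0 4 (x, y).
  rewrite /mprod -[X in _ ^+ X]card_ord -prodr_const; apply: ler_prod => j _; apply/andP; split.
    by rewrite invr_ge0.
  apply: mask_low => /=; apply: (le_trans (dilate_small _ _ b1_3)).
  rewrite exprS invfM; have : (3 ^+ (0 + j))^-1 <= 1 :> R by rewrite invf_le1 ?exprn_gt0// exprn_ege1// ler1n.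
  have : 0 <= (3 ^+ (0 + j))^-1 :> R by rewrite invr_ge0 exprn_ge0.
  set z := (_ ^+ _)^-1 => z0 z1.
  have := normr_ge0 x; set X := `|x| in hx * => X0; nra.
have h2 : 2^-1 <= power (dil 4 (x, y)).
  apply: le_trans (power_near0 hq1 hq2 hmu _).
  have := dilate_small x 4 b1_3; have := dilate_small y 4 b2_3; rewrite /dilate /= -/b1 -/b2.
  rewrite (_ : 3 ^+ 4 = 81); last by ring.
  have := normr_ge0 (x / b1 ^+ 4); have := normr_ge0 (y / b2 ^+ 4).
  set X := `|x / _|; set Y := `|y / _| => Y0 X0 hY hX.
  have hXY : X + Y <= 1/20 by lra.
  nra.
by rewrite /c0; apply: ler_pM => //; rewrite ?exprn_ge0 ?invr_ge0.
Qed.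

(* [mask] does not see the integer shifts by [b2 ^+ (m - j)] for [j <= m], so that
   only the factor beyond scale [m] feels the term [b2 ^+ m]. *)
Lemma power_shift x y m : power (x, y) * power ((dil m (x, y)).1, (dil m (x, y)).2 + 1)
  <= power (x, y + b2 ^+ m).
Proof.
have key j : (j <= m)%N -> dil j (x, y + b2 ^+ m) =
   ((dil j (x, y)).1, (dil j (x, y)).2 + ((B2 ^ (m - j))%N)%:~R).
  move=> jm; rewrite /dilate/= -/b1 -/b2 mulrDl; congr (_, _ + _).
  rewrite -[X in _ = X]/((B2 ^ (m - j))%N%:R : R) natrX natrM -/b2 -[in LHS](subnK jm) exprD mulfK//.
  by rewrite expf_neq0.
rewrite -[(x, y + _)](dilate0 q1 q2) (power_mprod 0 m) add0n key// subnn expn0.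
rewrite ler_wpM2r ?power_ge0//.
rewrite -{1}[(x, y)](dilate0 q1 q2) (power_mprod 0 m).
apply: (@le_trans _ _ (mprod 0 m (x, y))).
  by rewrite -[leRHS]mulr1 ler_wpM2l ?mprod_ge0 ?power_le1.
rewrite le_eqVlt; apply/orP; left; apply/eqP; apply: eq_bigr => j _.
rewrite key ?add0n// /maskp /=.
by rewrite -[X in _ = mask X _]addr0 -[0 in RHS]/(0%:~R) mask_int.
Qed.

(** If the extra term is absent or below the scale of the word, the rescaled frequency lies in the
    box of [power_box]. Otherwise [power_shift] splits the estimate into two such boxes, whence the
    square. *)
Lemma power_lam_low w : c0 ^+ 2 <= power (dil (size w) (lam w)).
Proof.
have c1 : c0 <= 1 by rewrite /c0; lra.
have c2 : c0 ^+ 2 <= c0 by have := c0_gt0; nra.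
have b1p : 0 < b1 by apply: lt_le_trans b1_3.
have b2p : 0 < b2 by apply: lt_le_trans b2_3.
have p1 : 0 < b1 ^+ size w by rewrite exprn_gt0.
have p2 : 0 < b2 ^+ size w by rewrite exprn_gt0.
have half (q : nat) : (1 <= q)%N ->
    `|(q%:Z * val3 (3 * q) w)%:~R / (3 * q%:R) ^+ size w| <= 2^-1 :> R.
  move=> hq.
  have p : 0 < (3 * q%:R) ^+ size w :> R by rewrite exprn_gt0// mulr_gt0// ltr0n.
  rewrite normrM [X in _ * X]ger0_norm ?invr_ge0 ?(ltW p)// ler_pdivrMr//.
  have h := qval3_half w hq.
  have : (2 * `|q%:Z * val3 (3 * q) w|)%:~R <= ((3 * q)%N%:Z ^+ size w)%:~R :> R by rewrite ler_int.
  by rewrite rmorphXn rmorphM /= intr_norm -[((3 * q)%N%:Z)%:~R]/((3 * q)%N%:R : R) natrM; lra.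
have [r rw sE] := sig_form w.
have r0 : 0 <= r%:R / b2 ^+ size w :> R by rewrite divr_ge0// ltW.
have r1 : r%:R / b2 ^+ size w <= 1 :> R.
  by rewrite ler_pdivrMr// mul1r /b2 -natrM -natrX ler_nat ltnW.
have h1 := half _ hq1; have h2 := half _ hq2.
rewrite -/b1 -/b2 -/B1 -/B2 in h1 h2.
have E : dil (size w) (lam w) = ((lam1 w)%:~R / b1 ^+ size w,
   (sig w)%:R / b2 ^+ size w - (q2%:Z * val3 B2 w)%:~R / b2 ^+ size w).
  by rewrite /dilate /lam /lam2 /= rmorphB /= mulrBl.
rewrite E /lam1; set x := (_ / b1 ^+ _) in h1 *; set z := ((q2%:Z * _)%:~R / b2 ^+ _) in h2 *.
have hz : - 2^-1 <= z <= 2^-1 by rewrite -ler_norml.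
case: sE => [->|[M ->]].
  by apply: (le_trans c2); apply: power_box => //; rewrite ler_norml; lra.
rewrite natrD mulrDl natrX natrM -/b2.
set r' := r%:R / _ in r0 r1 *.
have [Mw|wM] := ltnP M (size w).
  apply: (le_trans c2); apply: power_box => //.
  have [m0 m1] : 0 <= b2 ^+ M / b2 ^+ size w /\ b2 ^+ M / b2 ^+ size w <= 1.
    split; first by rewrite divr_ge0// exprn_ge0// ltW.
    by rewrite ler_pdivrMr// mul1r ler_eXn2l ?(ltnW Mw)// (lt_le_trans _ b2_3)// ltr1n.
  by rewrite ler_norml; lra.
have -> : b2 ^+ M / b2 ^+ size w = b2 ^+ (M - size w).
  by rewrite -{1}(subnK wM) exprD mulfK// expf_neq0.
have -> : r' + b2 ^+ (M - size w) - z = r' - z + b2 ^+ (M - size w) by ring.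
apply: le_trans (power_shift _ _ _); rewrite expr2.
have small (b v : R) n : 3 <= b -> `|v / b ^+ n| <= `|v|.
  move=> hb; apply: (le_trans (dilate_small _ _ hb)); rewrite -[leRHS]mulr1 ler_wpM2l//.
  by rewrite invf_le1 ?exprn_gt0// exprn_ege1// ler1n.
apply: ler_pM; rewrite ?(ltW c0_gt0)//; apply: power_box => //.
- by rewrite ler_norml; lra.
- by rewrite /dilate /=; apply: le_trans h1; exact: small.
- rewrite /dilate /= -/b2; have : `|(r' - z) / b2 ^+ (M - size w)| <= 3/2.
    by apply: (le_trans (small _ _ _ b2_3)); rewrite ler_norml; lra.
  by rewrite !ler_norml; lra.
Qed.

(** Up to the factor [9^-n], the Bessel sum over words of length [N] of the indicator of a cylinder
    of length [n], by [power_cyl]. *)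
Definition cum n N := \sum_(w <- words N) power (dil n (lam w)).

(** Padding with leading zeros embeds the shorter words into the longer ones without changing their
    frequencies. *)
Lemma sum_words_mono (F : R * R -> R) M N : (M <= N)%N ->
  (forall w, size w = N -> 0 <= F (lam w)) ->
  \sum_(w <- words M) F (lam w) <= \sum_(w <- words N) F (lam w).
Proof.
move=> MN; rewrite -(subnK MN); elim: (N - M)%N => [|k IH] F0 //.
have F0' w : size w = (k + M)%N -> 0 <= F (lam w).
  by move=> sw; rewrite -lam0; apply: F0; rewrite /= sw.
apply: (le_trans (IH F0')); rewrite addSn sum_words big_ord_recl/=.
under [X in _ <= X + _]eq_bigr do rewrite lam0.
rewrite lerDl; apply: sumr_ge0 => d _; rewrite big_seq; apply: sumr_ge0 => w.
by rewrite mem_words => /eqP sw; apply: F0; rewrite /= sw addSn.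
Qed.

Lemma cum_le n N : cum n N <= 3 ^+ n.
Proof.
apply: (@le_trans _ _ (cum n (n + N))).
  by apply: (@sum_words_mono (fun l => power (dil n l))) => [|w _]; [exact: leq_addl|exact: power_ge0].
rewrite -(sum_mprod n N); apply: ler_sum => w _; rewrite (power_mprod n N).
by rewrite -[leRHS]mulr1 ler_wpM2l ?mprod_ge0 ?power_le1.
Qed.

Lemma power_dilate_near1 (L : seq (R * R)) e : 0 < e ->
  exists N0, forall N, (N0 <= N)%N -> {in L, forall l, 1 - e <= power (dil N l)}.
Proof.
move=> e0; elim: L => [|l L [N0 IH]]; first by exists 0%N.
set s := `|l.1| + `|l.2|.
have s0 : 0 <= 16 * s ^+ 2 / e by rewrite divr_ge0 ?(ltW e0)// mulr_ge0// sqr_ge0.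
exists (maxn N0 (Num.bound (16 * s ^+ 2 / e))) => N; rewrite geq_max => /andP[hN0 hN] l'.
rewrite inE => /predU1P[->|]; last exact: IH.
apply: le_trans (power_near0 hq1 hq2 hmu _); rewrite lerD2l lerN2.
have hb := archi_boundP s0.
have hN' : (Num.bound (16 * s ^+ 2 / e))%:R <= 3 ^+ N :> R.
  by rewrite -natrX ler_nat; apply: (leq_trans hN); rewrite ltnW// ltn_expl.
have h : 16 * s ^+ 2 <= e * 3 ^+ N.
  by rewrite -ler_pdivrMl// mulrC; apply: (le_trans (ltW hb)).
have h3 : 1 <= 3 ^+ N :> R by rewrite exprn_ege1// ler1n.
have : `|(dil N l).1| + `|(dil N l).2| <= s / 3 ^+ N.
  by rewrite mulrDl; apply: lerD; exact: dilate_small.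
set t := _ + _ => ht; have t0 : 0 <= t by rewrite addr_ge0.
have hs : t * 3 ^+ N <= s by rewrite -ler_pdivlMr// exprn_gt0.
set T := 3 ^+ N in h3 h hs; have T0 : 0 < T by lra.
rewrite -(ler_pM2r T0); apply: le_trans h.
have : t ^+ 2 * T <= s ^+ 2.
  apply: (@le_trans _ _ ((t * T) ^+ 2)); last by rewrite lerXn2r ?nnegrE ?mulr_ge0//; nra.
  rewrite exprMn ler_wpM2l ?sqr_ge0//; nra.
by lra.
Qed.

(* Tannery's theorem: the truncated products sum to [3 ^ n] at every level, they
   converge to [power] termwise and are dominated by [power / c0 ^ 2]. *)
Lemma cum_cvg n e : 0 < e -> exists2 N, (n <= N)%N & 3 ^+ n - e <= cum n N.
Proof.
move=> e0; set c := c0 ^+ 2; have c_gt0 : 0 < c by rewrite exprn_gt0// c0_gt0.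
pose A := [set cum n N | N in [set: nat]].
have A0 : A !=set0 by exists (cum n 0); exists 0%N.
have Aub : ubound A (3 ^+ n) by move=> _ [N _ <-]; exact: cum_le.
have hA : has_sup A by split => //; exists (3 ^+ n).
(* Chosen so that [d + d / c = e], the total loss at the end. *)
pose d := e / (1 + c^-1).
have ci : 0 < 1 + c^-1 by rewrite addr_gt0// invr_gt0.
have d0 : 0 < d by rewrite divr_gt0.
have [_ [M0 _ <-] hM0] := sup_adherent d0 hA.
pose M := maxn M0 n.
have mono a b : (a <= b)%N -> cum n a <= cum n b.
  by move=> ab; apply: (@sum_words_mono (fun l => power (dil n l))) => // w _; exact: power_ge0.
have hM : sup A - d < cum n M by apply: (lt_le_trans hM0); apply: mono; rewrite leq_maxl.
have d3 : 0 < d / 3 ^+ M by rewrite divr_gt0// exprn_gt0.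
have [N0 hN0] := power_dilate_near1 [seq lam w | w <- words M] d3.
pose N := maxn N0 M.
have nN : (n <= N)%N by rewrite /N /M !leq_max leqnn !orbT.
exists M; first by rewrite /M leq_maxr.
have cN : cum n N <= sup A by apply: ub_le_sup; [exists (3 ^+ n)|exists N].
have low w : size w = N -> c * mprod n (N - n) (lam w) <= power (dil n (lam w)).
  move=> sw; rewrite (power_mprod n (N - n)) subnKC// mulrC ler_wpM2l ?mprod_ge0//.
  by rewrite -sw; exact: power_lam_low.
(* [power - c * mprod] is nonnegative at level [N], so its sum grows from [M] to [N]. The part of
   the constant sum [3^n] carried by words outside level [M] is thus paid for by the small tail of
   [cum]. *)
have key : c * 3 ^+ n <= c * \sum_(w <- words M) mprod n (N - n) (lam w) + (cum n N - cum n M).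
  have := @sum_words_mono (fun l => power (dil n l) - c * mprod n (N - n) l) M N.
  rewrite /N leq_maxr -/N => /(_ isT) H.
  have {H} := H (fun w sw => ltac:(rewrite subr_ge0; exact: low)).
  rewrite !sumrB -!mulr_sumr -/(cum n M) -/(cum n N).
  by rewrite -{3}(subnKC nN) sum_mprod; lra.
(* On the finitely many words of level [M] the remaining factor is at least [1 - d / 3^M], so
   truncation loses at most [d] in total. *)
have near : \sum_(w <- words M) mprod n (N - n) (lam w) <= cum n M + d.
  have -> : d = \sum_(w <- words M) d / 3 ^+ M.
    rewrite big_const_seq count_predT size_words iter_addr_0 -[d / _ *+ _]mulr_natr natrX mulfVK//.
  rewrite -big_split/= big_seq [leRHS]big_seq; apply: ler_sum => w hw.
  have := hN0 N (leq_maxl _ _) (lam w) (map_f _ hw).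
  rewrite (power_mprod n (N - n)) subnKC//.
  have := mprod_ge0 n (N - n) (lam w); have := mprod_le1 n (N - n) (lam w).
  set P := mprod _ _ _; set Q := power _ => P1 P0 hQ; nra.
have : c * (3 ^+ n - cum n M - d) <= d by have := ler_wpM2l (ltW c_gt0) near; lra.
rewrite -ler_pdivlMl//.
have : e = d + c^-1 * d by rewrite -[X in X + _]mul1r -mulrDl mulrC /d mulfVK// gt_eqF.
by lra.
Qed.

End Frequencies.

(** * An integrable function with zero integral on every cylinder vanishes almost everywhere *)

Section CylindersSeparate.
Context (R : realType) (q1 q2 : nat) (hq1 : (1 <= q1)%N) (hq2 : (1 <= q2)%N).
Variable mu : probability (R * R)%type R.
Hypothesis hmu : is_sierpinski_measure q1 q2 mu.
Let b1 : R := 3 * q1%:R.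
Let b2 : R := 3 * q2%:R.
Notation S := (simil b1 b2).
Notation cyl := (cyl (R := R) q1 q2).
Notation dig := (dig (R := R) q1 q2).
Notation shift := (shift (R := R) q1 q2).

(** [shift] preserves null sets: in the self-similar formula for the preimage, [shift] undoes each
    [simil d] almost everywhere. *)
Lemma ae_shift (P : R * R -> Prop) : {ae mu, forall x, P x} -> {ae mu, forall x, P (shift x)}.
Proof.
move=> [N [mN N0 PN]]; exists (shift @^-1` N); split; last by move=> x /= /PN.
  by rewrite -[X in measurable X]setTI; apply: measurable_shift.
have mE : measurable (shift @^-1` N).
  by rewrite -[X in measurable X]setTI; apply: measurable_shift.
rewrite (sierpinski_simil hq1 hq2 hmu mE) big1 ?mule0// => d _.
apply: measure_negligible.
  by rewrite -[X in measurable X]setTI; apply: measurable_simil.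
have [N' [mN' N'0 hN']] := ae_quarter hq1 hq2 hmu.
exists (N `|` N'); split; first exact: measurableU.
  by apply/null_set_setU.
move=> x /= Nx; have [qx|qx] := pselect (quarter x); last by right; exact: hN'.
by left; move: Nx; rewrite shift_simil.
Qed.

Lemma ae_orbit_quarter : {ae mu, forall x, forall n, quarter (iter n shift x)}.
Proof.
apply: ae_foralln; elim => [|n IH]; first exact: (ae_quarter hq1 hq2 hmu).
by have := ae_shift IH; apply: filterS => x /=; rewrite -iterSr.
Qed.

Definition expand (g : 'I_3 -> R) (b : R) n (x : R * R) : R :=
  \sum_(j < n) g (dig (iter j shift x)) / b ^+ j.+1.

Lemma expand_fst n x : x.1 = expand (dg1 R) b1 n x + (iter n shift x).1 / b1 ^+ n.
Proof.
elim: n => [|n IH]; first by rewrite /expand big_ord0 add0r expr0 divr1.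
have n0 := @b1_neq0 R q1 hq1.
rewrite [LHS]IH /expand big_ord_recr/= -addrA; congr (_ + _).
rewrite /shift/= exprS; set y := iter n shift x; rewrite -/b1.
by field; rewrite n0 expf_neq0.
Qed.

Lemma expand_snd n x : x.2 = expand (dg2 R) b2 n x + (iter n shift x).2 / b2 ^+ n.
Proof.
elim: n => [|n IH]; first by rewrite /expand big_ord0 add0r expr0 divr1.
have n0 := @b2_neq0 R q2 hq2.
rewrite [LHS]IH /expand big_ord_recr/= -addrA; congr (_ + _).
rewrite /shift/= exprS; set y := iter n shift x; rewrite -/b2.
by field; rewrite n0 expf_neq0.
Qed.

Lemma expand_cvg g b x : 3 <= b -> (forall d, 0 <= g d <= 1) -> cvgn (fun n => expand g b n x).
Proof.
move=> b3 g01; have b0 : 0 < b by lra.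
apply: nondecreasing_is_cvgn.
  apply/nondecreasing_seqP => n; rewrite /expand big_ord_recr/= lerDl divr_ge0 ?exprn_ge0 ?(ltW b0)//.
  by have /andP[] := g01 (dig (iter n shift x)).
exists 1 => _ [n _ <-].
(* The upper bound [1] alone is not inductive; the term [b^-n] pays for the next digit. *)
suff : expand g b n x <= 1 - (b ^+ n)^-1.
  by move=> h; apply: (le_trans h); rewrite gerBl invr_ge0 exprn_ge0// ltW.
elim: n => [|n IH]; first by rewrite /expand big_ord0 expr0 invr1 subrr.
rewrite /expand big_ord_recr/= -/(expand g b n x).
have /andP[_ g1] := g01 (dig (iter n shift x)).
have h : g (dig (iter n shift x)) / b ^+ n.+1 <= (b ^+ n.+1)^-1.
  by rewrite -[leRHS]mul1r ler_wpM2r// invr_ge0 exprn_ge0// ltW.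
have : (b ^+ n)^-1 = b * (b ^+ n.+1)^-1 by rewrite exprS invfM mulrA mulfV ?mul1r// gt_eqF.
have : 0 <= (b ^+ n.+1)^-1 by rewrite invr_ge0 exprn_ge0// ltW.
by nra.
Qed.

Lemma residue_cvg0 (y : R^nat) b : 3 <= b -> (forall n, 0 <= y n <= 2^-1) ->
  (fun n => y n / b ^+ n) @ \oo --> (0 : R).
Proof.
move=> b3 hy; have b0 : 0 < b by lra.
apply: (@squeeze_cvgr _ _ _ _ (cst 0) (fun n => b^-1 ^+ n)).
- apply: nearW => n; have /andP[y0 y1] := hy n.
  rewrite /= divr_ge0 ?exprn_ge0 ?(ltW b0)//= exprVn -[leRHS]mul1r ler_wpM2r ?invr_ge0 ?exprn_ge0 ?(ltW b0)//.
  by lra.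
- exact: cvg_cst.
- by apply: cvg_expr; rewrite ger0_norm ?invr_ge0 ?(ltW b0)// invf_lt1//; lra.
Qed.

(** Two cylinders are nested or disjoint, so adjoining the empty set gives a pi-system. *)
Definition cyls : set (set (R * R)) := [set E | E = set0 \/ exists s, E = cyl s].

Lemma cyls_setI : setI_closed cyls.
Proof.
suff H s s' : cyls (cyl s `&` cyl s').
  move=> _ _ [->|[s ->]] [->|[s' ->]]; rewrite ?setI0 ?set0I; by [left|exact: H].
elim: s s' => [|d s IH] [|d' s'] /=; rewrite ?setTI ?setIT.
- by right; exists [::].
- by right; exists (d' :: s').
- by right; exists (d :: s).
have [<-|dd'] := eqVneq d d'; last first.
  by left; apply/seteqP; split => // x [[e1 _] [e2 _]]; move: dd'; rewrite -e1 e2 eqxx.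
have [e|[t e]] := IH s'; last first.
  right; exists (d :: t) => /=; apply/seteqP; split => x /=; rewrite -e.
    by move=> [[? ?] [? ?]].
  by move=> [? [? ?]].
left; apply/seteqP; split => // x [[_ h1] [_ h2]].
by have : (cyl s `&` cyl s') (shift x) by []; rewrite e.
Qed.

Notation C := (g_sigma_algebraType cyls).

Lemma cyls_measurable : <<s cyls >> `<=` (measurable : set (set (R * R))).
Proof.
apply: smallest_sub; first exact: sigma_algebra_measurable.
by move=> _ [->|[s ->]]; [exact: measurable0|exact: measurable_cyl].
Qed.

Lemma iter_dig_cyls n d : <<s cyls >> [set x | dig (iter n shift x) = d].
Proof.
have -> : [set x | dig (iter n shift x) = d] = \bigcup_(s in [set` words n]) cyl (s ++ [:: d]).
  elim: n => [|n IH].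
    apply/seteqP; split => x /=; first by move=> h; exists [::].
    by move=> [s /=]; rewrite inE => /eqP -> /= [].
  apply/seteqP; split => x.
    rewrite /= -iterS iterSr => h.
    have : [set x | dig (iter n shift x) = d] (shift x) by [].
    rewrite IH => -[s hs sx]; exists (dig x :: s) => //.
    by move: hs; rewrite /= -/(words n.+1) !mem_words.
  move=> [[|e s]]; rewrite /= -/(words n.+1) mem_words//= eqSS -mem_words => hs [_ h].
  rewrite -iterS iterSr.
  have : [set x | dig (iter n shift x) = d] (shift x) by rewrite IH; exists s.
  by [].
apply: (@fin_bigcup_measurable _ C); first exact: finite_seq.
by move=> s _; apply: sub_sigma_algebra; right; exists (s ++ [:: d]).
Qed.

Lemma measurable_expand g b n : measurable_fun setT (expand g b n : C -> R).
Proof.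
apply: measurable_sum => j; apply: measurable_funM => //.
rewrite (_ : (fun x => _) = (fun x : C => \sum_(d < 3) g d * \1_([set y | dig (iter j shift y) = d] : set C) x)).
  apply: measurable_sum => d; apply: measurable_funM => //.
  by apply: measurable_indic; exact: iter_dig_cyls.
apply/funext => x; rewrite (bigD1 (dig (iter j shift x)))//= indicE mem_set// mulr1 big1 ?addr0// => d hd.
by rewrite indicE memNset ?mulr0//= => e; rewrite e eqxx in hd.
Qed.

(** The point rebuilt from its digits. It is measurable for the sigma-algebra of cylinders and
    almost everywhere equal to the identity, so every Borel set is, up to a null set, in that
    sigma-algebra. *)
Definition decode (x : R * R) : R * R :=
  (limn (fun n => expand (dg1 R) b1 n x), limn (fun n => expand (dg2 R) b2 n x)).

Let dg01 (d : 'I_3) : (0 <= dg1 R d <= 1) && (0 <= dg2 R d <= 1).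
Proof. by rewrite /dg1 /dg2 !ler0n !lern1/=; case: eqP => //; case: eqP. Qed.

Lemma measurable_decode : measurable_fun setT (decode : C -> (R * R)%type).
Proof.
apply: measurable_fun_pair.
  apply: (@measurable_fun_cvg _ C R setT (fun n => expand (dg1 R) b1 n : C -> R)) => [n|x _].
    exact: measurable_expand.
  by apply: expand_cvg => [|d]; [exact: ratio_ge3|have /andP[] := dg01 d].
apply: (@measurable_fun_cvg _ C R setT (fun n => expand (dg2 R) b2 n : C -> R)) => [n|x _].
  exact: measurable_expand.
by apply: expand_cvg => [|d]; [exact: ratio_ge3|have /andP[] := dg01 d].
Qed.

Lemma ae_decode : {ae mu, forall x, decode x = x}.
Proof.
apply: filterS ae_orbit_quarter => x hx; rewrite /decode [RHS]surjective_pairing; congr (_, _).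
  have h : (fun n => (iter n shift x).1 / b1 ^+ n) @ \oo --> (0 : R).
    by apply: residue_cvg0 => [|n]; [exact: ratio_ge3|have [-> ->] := hx n].
  apply/cvg_lim => //.
  rewrite (_ : (fun n => _) = (fun n => x.1 - (iter n shift x).1 / b1 ^+ n)).
    by rewrite -[X in _ --> X]subr0; apply: cvgB => //; exact: cvg_cst.
  by apply/funext => n; rewrite [in RHS](expand_fst n x) addrK.
have h : (fun n => (iter n shift x).2 / b2 ^+ n) @ \oo --> (0 : R).
  by apply: residue_cvg0 => [|n]; [exact: ratio_ge3|have [_ _ -> ->] := hx n].
apply/cvg_lim => //.
rewrite (_ : (fun n => _) = (fun n => x.2 - (iter n shift x).2 / b2 ^+ n)).
  by rewrite -[X in _ --> X]subr0; apply: cvgB => //; exact: cvg_cst.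
by apply/funext => n; rewrite [in RHS](expand_snd n x) addrK.
Qed.

Lemma integral_indic_Ex u (E : set (R * R)) : integ mu u -> measurable E ->
  (\int[mu]_(x in E) (u x)%:E = (Ex mu (fun x => \1_E x * u x)%R)%:E)%E.
Proof.
move=> ui mE; rewrite integral_mkcond -integralEx.
  by apply: eq_integral => x _; rewrite /patch indicE; case: ifP; rewrite ?mul1r ?mul0r.
under [X in integ _ X]eq_fun do rewrite mulrC.
by apply: integM => //; exact: bmeas_indic.
Qed.

(** Sets of zero integral form a Dynkin class containing the pi-system [cyls]; [decode] carries the
    conclusion over to Borel sets. *)
Lemma cyl_separate u : integ mu u -> (forall s, Ex mu (fun x => \1_(cyl s) x * u x) = 0) ->
  {ae mu, forall x, u x = 0}.
Proof.
move=> ui hu.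
have mu_ : measurable_fun setT u by apply/measurable_EFinP; exact: measurable_int ui.
pose P : set (set (R * R)) := [set E | (\int[mu]_(x in E) (u x)%:E = 0)%E].
have PT : P setT.
  by rewrite /P /= integral_indic_Ex//; have := hu [::] => /= ->.
have PC E : <<s cyls >> E -> P E.
  apply: (@dynkin_induction _ C cyls P) => //.
  - exact: cyls_setI.
  - move=> _ [->|[s ->]]; first by rewrite /P /= integral_set0.
    by rewrite /P /= integral_indic_Ex ?hu//; exact: measurable_cyl.
  - move=> E' /cyls_measurable mE PE.
    have := PT; rewrite /P /= -(setUv E') integral_setU//=.
    + by move: PE; rewrite /P /= => ->; rewrite add0e.
    + exact: measurableC.
    + by rewrite setUv; exact/measurable_EFinP.
    + by rewrite disj_set2E setICr.
  - move=> F mF tF PF; rewrite /P /= integral_bigcup//.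
    + by rewrite eseries0// => n _ _; exact: PF.
    + by move=> k; apply: cyls_measurable; exact: mF.
    + apply: (@integrableS _ _ _ _ setT) => //.
      by apply: bigcup_measurable => k _; apply: cyls_measurable; exact: mF.
have PB E : measurable E -> P E.
  move=> mE.
  have hE : <<s cyls >> (decode @^-1` E).
    by have := measurable_decode measurableT mE; rewrite setTI.
  have mE' := cyls_measurable hE.
  have := PC _ hE; rewrite /P /= !integral_indic_Ex// => -[h]; congr EFin; rewrite -[RHS]h.
  apply: ae_eq_Ex.
  - by apply: measurable_funM => //; exact: measurable_indic.
  - by apply: measurable_funM => //; exact: measurable_indic.
  - apply: filterS ae_decode => x hx; congr (_ * _); rewrite !indicE; congr (_%:R).
    by congr (nat_of_bool _); apply/idP/idP; rewrite !inE/= hx.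
have : ae_eq mu setT (EFin \o u) (cst 0%E).
  apply: integral_ae_eq => // E _ mE; rewrite integral0; exact: PB.
by apply: filterS => x /(_ I) /= [].
Qed.

End CylindersSeparate.

(** * The frequencies form a spectrum *)

Section Spectrum.
Context (R : realType) (q1 q2 : nat) (hq1 : (1 <= q1)%N) (hq2 : (1 <= q2)%N).
Variable mu : probability (R * R)%type R.
Hypothesis hmu : is_sierpinski_measure q1 q2 mu.
Variable sig : seq 'I_3 -> nat.
Hypothesis sig_mod : forall d w, (sig (d :: w) = sig w %[mod (3 * q2) ^ (size w).+1])%N.
Hypothesis sig0 : forall w, sig (ord0 :: w) = sig w.
Hypothesis sig_form : forall w, exists2 r, (r < (3 * q2) ^ size w)%N &
  sig w = r \/ exists M, sig w = (r + (3 * q2) ^ M)%N.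
Notation lam := (lam R q1 q2 sig).
Notation cyl := (cyl (R := R) q1 q2).

Lemma power_eq0 l : power mu l = 0 -> FC mu l = 0 /\ FS mu l = 0.
Proof. by move=> /eqP; rewrite paddr_eq0 ?sqr_ge0// !sqrf_eq0 => /andP[/eqP -> /eqP ->]. Qed.

Lemma angB (l l' x : R * R) : ang (l - l') x = ang l x - ang l' x.
Proof. by rewrite /ang /dot2 /=; ring. Qed.

Section Projection.
Variables (s : seq 'I_3) (N : nat).
(** [C + i D] is a Fourier coefficient of the cylinder and [A + i B = (C + i D) exp(- i ang)] its
    component along a character. Thus [res1 - i res2] is what remains of the indicator after
    projection on the characters of length [N]. *)
Let C w := Ex mu (fun x => \1_(cyl s) x * cos (ang (lam w) x)).
Let D w := Ex mu (fun x => \1_(cyl s) x * sin (ang (lam w) x)).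
Let A w x := C w * cos (ang (lam w) x) + D w * sin (ang (lam w) x).
Let B w x := D w * cos (ang (lam w) x) - C w * sin (ang (lam w) x).

Definition res1 (x : R * R) : R := \1_(cyl s) x - \sum_(w <- words N) A w x.
Definition res2 (x : R * R) : R := \sum_(w <- words N) B w x.

Let bA w : bmeas (A w).
Proof. by apply: bmeasD; apply: bmeasZ; [exact: bmeas_cos_ang|exact: bmeas_sin_ang]. Qed.

Let bB w : bmeas (B w).
Proof. by apply: bmeasB; apply: bmeasZ; [exact: bmeas_cos_ang|exact: bmeas_sin_ang]. Qed.

Let b1C : bmeas (\1_(cyl s) : R * R -> R).
Proof. by apply: bmeas_indic; exact: measurable_cyl. Qed.

Lemma bmeas_res1 : bmeas res1.
Proof. by apply: bmeasB => //; exact: bmeas_sum. Qed.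

Lemma bmeas_res2 : bmeas res2.
Proof.
by apply: bmeas_sum.
Qed.

Lemma Ex_pair w w' : size w = N -> size w' = N ->
  Ex mu (fun x => A w x * A w' x + B w x * B w' x) = if w == w' then C w ^+ 2 + D w ^+ 2 else 0.
Proof.
move=> sw sw'.
have -> : Ex mu (fun x => A w x * A w' x + B w x * B w' x) =
  Ex mu (fun x => (C w * C w' + D w * D w') * cos (ang (lam w - lam w') x)
     + (D w * C w' - C w * D w') * sin (ang (lam w - lam w') x)).
  by apply: eq_Ex => x; rewrite /A /B angB cosB sinB; ring.
have ic := bmeas_integ mu (bmeas_cos_ang (lam w - lam w')).
have is_ := bmeas_integ mu (bmeas_sin_ang (lam w - lam w')).
rewrite ExD ?ExZ//; [|exact: integZ..].
rewrite -/(FC mu _) -/(FS mu _); case: eqP => [->|/eqP ww'].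
  have e x : ang (lam w' - lam w') x = 0 by rewrite angB subrr.
  have -> : FC mu (lam w' - lam w') = 1.
    by rewrite -[RHS](Ex_cst mu 1); apply: eq_Ex => x; rewrite e cos0.
  by rewrite [D w' * C w']mulrC subrr mul0r addr0 mulr1 !expr2.
have [|-> ->] := @power_eq0 (lam w - lam w'); last by rewrite !mulr0 addr0.
by apply: power_orth => //; rewrite sw sw'.
Qed.

(** Pythagoras: squared norm of the indicator minus the sum of the squared coefficients. *)
Lemma Ex_res : Ex mu (fun x => res1 x ^+ 2 + res2 x ^+ 2) =
  (3 ^+ size s)^-1 - (9 ^+ size s)^-1 * cum q1 q2 sig mu (size s) N.
Proof.
have E x : res1 x ^+ 2 + res2 x ^+ 2 = (\1_(cyl s) x - 2 * (\sum_(w <- words N) \1_(cyl s) x * A w x))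
  + \sum_(w <- words N) \sum_(w' <- words N) (A w x * A w' x + B w x * B w' x).
  have -> : \sum_(w <- words N) \sum_(w' <- words N) (A w x * A w' x + B w x * B w' x)
    = (\sum_(w <- words N) A w x) ^+ 2 + (\sum_(w <- words N) B w x) ^+ 2.
    rewrite !expr2 !mulr_suml -big_split/=; apply: eq_bigr => w _.
    by rewrite !mulr_sumr -big_split.
  rewrite /res1 /res2 -mulr_sumr indicE.
  have : (x \in cyl s)%:R ^+ 2 = (x \in cyl s)%:R :> R.
    by case: (_ \in _); rewrite ?expr1n// expr0n.
  by set e := _%:R; set a := \sum_(_ <- _) _; set b := \sum_(_ <- _) _; lra.
have iAB w w' : integ mu (fun x => A w x * A w' x + B w x * B w' x).
  by apply: bmeas_integ; apply: bmeasD; apply: bmeasM.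
have i1A w : integ mu (fun x => \1_(cyl s) x * A w x) by apply: bmeas_integ; exact: bmeasM.
have i1 : integ mu (\1_(cyl s)) by exact: bmeas_integ.
rewrite (eq_Ex mu E) ExD; last 2 first.
- by apply: integB => //; apply: integZ; exact: integ_sum.
- by apply: integ_sum => w; exact: integ_sum.
rewrite ExB ?ExZ//; last 2 first.
- exact: integ_sum.
- by apply: integZ; exact: integ_sum.
rewrite !Ex_sum//; last by move=> w; exact: integ_sum.
rewrite (Ex_cyl hq1 hq2 hmu).
have -> : \sum_(w <- words N) Ex mu (fun x => \1_(cyl s) x * A w x) =
    \sum_(w <- words N) (C w ^+ 2 + D w ^+ 2).
  apply: eq_bigr => w _.
  rewrite (@eq_Ex _ _ _ _ _ (fun x => C w * (\1_(cyl s) x * cos (ang (lam w) x)) +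
      D w * (\1_(cyl s) x * sin (ang (lam w) x)))); last by move=> x; rewrite /A; ring.
  have ic : integ mu (fun x => \1_(cyl s) x * cos (ang (lam w) x)).
    by apply: bmeas_integ; apply: bmeasM => //; exact: bmeas_cos_ang.
  have is_ : integ mu (fun x => \1_(cyl s) x * sin (ang (lam w) x)).
    by apply: bmeas_integ; apply: bmeasM => //; exact: bmeas_sin_ang.
  by rewrite ExD ?ExZ//; exact: integZ.
have -> : \sum_(w <- words N) Ex mu (fun x => \sum_(w' <- words N) (A w x * A w' x + B w x * B w' x))
   = \sum_(w <- words N) (C w ^+ 2 + D w ^+ 2).
  rewrite big_seq [RHS]big_seq; apply: eq_bigr => w hw; rewrite Ex_sum//.
  rewrite (bigD1_seq w) ?uniq_words//= big_seq_cond big1 ?addr0.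
    by move: hw; rewrite mem_words => /eqP hw; rewrite Ex_pair// eqxx.
  move=> w' /andP[]; move: hw; rewrite !mem_words => /eqP hw /eqP hw' ww'.
  by rewrite Ex_pair// eq_sym (negbTE ww').
have -> : \sum_(w <- words N) (C w ^+ 2 + D w ^+ 2) =
    (9 ^+ size s)^-1 * cum q1 q2 sig mu (size s) N.
  by rewrite /cum mulr_sumr; apply: eq_bigr => w _; exact: (power_cyl hq1 hq2 hmu).
by ring.
Qed.

Variables u v : R * R -> R.
Hypotheses (iu : integ mu u) (iv : integ mu v).
Hypothesis perp : forall w,
  Ex mu (fun x => u x * cos (ang (lam w) x) - v x * sin (ang (lam w) x)) = 0 /\
  Ex mu (fun x => u x * sin (ang (lam w) x) + v x * cos (ang (lam w) x)) = 0.

(** Since [u + i v] is orthogonal to every character, the projection of the indicator may be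
    subtracted inside the inner product. *)
Lemma Ex_perp_res :
  Ex mu (fun x => \1_(cyl s) x * u x) = Ex mu (fun x => u x * res1 x - v x * res2 x).
Proof.
pose p1 w x := u x * cos (ang (lam w) x) - v x * sin (ang (lam w) x).
pose p2 w x := u x * sin (ang (lam w) x) + v x * cos (ang (lam w) x).
have ip1 w : integ mu (p1 w).
  by apply: integB; apply: integM => //; [exact: bmeas_cos_ang|exact: bmeas_sin_ang].
have ip2 w : integ mu (p2 w).
  by apply: integD; apply: integM => //; [exact: bmeas_sin_ang|exact: bmeas_cos_ang].
have E x : u x * res1 x - v x * res2 x =
    u x * \1_(cyl s) x - \sum_(w <- words N) (C w * p1 w x + D w * p2 w x).
  have -> : \sum_(w <- words N) (C w * p1 w x + D w * p2 w x) =
     u x * (\sum_(w <- words N) A w x) + v x * (\sum_(w <- words N) B w x).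
    rewrite !mulr_sumr -big_split/=; apply: eq_bigr => w _; rewrite /p1 /p2 /A /B; ring.
  by rewrite /res1 /res2; ring.
have isum : integ mu (fun x => \sum_(w <- words N) (C w * p1 w x + D w * p2 w x)).
  by apply: integ_sum => w; apply: integD; exact: integZ.
rewrite (eq_Ex mu E) ExB//; last exact: integM.
rewrite Ex_sum; last by move=> w; apply: integD; exact: integZ.
rewrite [X in _ = _ - X]big1 ?subr0.
  by apply: eq_Ex => x; rewrite mulrC.
move=> w _; have [h1 h2] := perp w.
rewrite ExD ?ExZ//; [|exact: integZ..].
by rewrite [Ex mu (p1 w)]h1 [Ex mu (p2 w)]h2 !mulr0 addr0.
Qed.

End Projection.

(** Stands in for the Cauchy-Schwarz inequality; the weight [t] is later sent to [0]. *)
Lemma young (a b t : R) : 0 < t -> a * b <= t * a ^+ 2 + b ^+ 2 / t.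
Proof.
move=> t0; have -> : b = t * (b / t) by rewrite mulrC mulfVK// gt_eqF.
set c := b / t; rewrite (_ : (t * c) ^+ 2 / t = t * c ^+ 2); last by field; rewrite gt_eqF.
rewrite -mulrDr mulrCA ler_pM2l//; nra.
Qed.

Lemma perp_cyl_le0 u v : integ mu u -> integ mu v ->
  integ mu (fun x => u x ^+ 2) -> integ mu (fun x => v x ^+ 2) ->
  (forall w,
  Ex mu (fun x => u x * cos (ang (lam w) x) - v x * sin (ang (lam w) x)) = 0 /\
  Ex mu (fun x => u x * sin (ang (lam w) x) + v x * cos (ang (lam w) x)) = 0) ->
  forall s, Ex mu (fun x => \1_(cyl s) x * u x) <= 0.
Proof.
move=> iu iv iu2 iv2 perp s.
set K := Ex mu (fun x => u x ^+ 2) + Ex mu (fun x => v x ^+ 2).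
have K0 : 0 <= K by rewrite addr_ge0//; apply: Rintegral_ge0 => x _; exact: sqr_ge0.
have key t : 0 < t -> Ex mu (fun x => \1_(cyl s) x * u x) <= t * (K + 1).
  move=> t0; have t2 : 0 < t ^+ 2 by rewrite exprn_gt0.
  (* Precision [t^2], because the squared residual comes divided by [t] and must cost only [t]. *)
  have [N _ hN] := cum_cvg hq1 hq2 sig_mod sig0 sig_form hmu (size s) t2.
  have br1 := bmeas_res1 s N; have br2 := bmeas_res2 s N.
  have ir : integ mu (fun x => res1 s N x ^+ 2 + res2 s N x ^+ 2).
    by apply: bmeas_integ; apply: bmeasD; exact: bmeasM.
  rewrite (Ex_perp_res s N iu iv perp).
  apply: (@le_trans _ _ (Ex mu (fun x => t * (u x ^+ 2 + v x ^+ 2)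
      + t^-1 * (res1 s N x ^+ 2 + res2 s N x ^+ 2)))).
    apply: le_Ex.
    - by apply: integB; exact: integM.
    - by apply: integD; apply: integZ => //; exact: integD.
    - move=> x; have := young (u x) (res1 s N x) t0; have := young (- v x) (res2 s N x) t0.
      by rewrite sqrrN; set z := t^-1; lra.
  rewrite ExD; last 2 first.
  - by apply: integZ; exact: integD.
  - exact: integZ.
  rewrite !ExZ//; last exact: integD.
  rewrite (ExD iu2 iv2) -/K [t * (K + 1)]mulrDr mulr1 lerD2l.
  rewrite ler_pdivrMl// -expr2 Ex_res.
  have e3 : (3 ^+ size s)^-1 = (9 ^+ size s)^-1 * 3 ^+ size s :> R.
    rewrite (_ : 9 = 3 * 3); last by ring.
    by rewrite exprMn invfM mulfVK// expf_neq0.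
  rewrite e3 -mulrBr; have : (9 ^+ size s)^-1 <= 1 :> R.
    by rewrite invf_le1 ?exprn_gt0// exprn_ege1// ler1n.
  have : 0 <= (9 ^+ size s)^-1 :> R by rewrite invr_ge0 exprn_ge0.
  set a := (9 ^+ _)^-1; set z := 3 ^+ _ - _ => a0 a1.
  have hz : z <= t ^+ 2 by rewrite /z; lra.
  have [z0|z0] := lerP 0 z; nra.
rewrite leNgt; apply/negP => h; set m := Ex mu _ in h key.
have K1 : 0 < K + 1 by lra.
have m2 : 0 < m / 2 / (K + 1) by rewrite !divr_gt0.
have := key _ m2; rewrite mulfVK ?gt_eqF//; lra.
Qed.

(** The one-sided bound applied to [(u, v)] and to [(-u, -v)] gives zero on every cylinder. *)
Lemma perp_ae0 u v : integ mu u -> integ mu v ->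
  integ mu (fun x => u x ^+ 2) -> integ mu (fun x => v x ^+ 2) ->
  (forall w,
  Ex mu (fun x => u x * cos (ang (lam w) x) - v x * sin (ang (lam w) x)) = 0 /\
  Ex mu (fun x => u x * sin (ang (lam w) x) + v x * cos (ang (lam w) x)) = 0) ->
  {ae mu, forall x, u x = 0}.
Proof.
move=> iu iv iu2 iv2 perp; apply: (cyl_separate hq1 hq2 hmu iu) => s.
apply/eqP; rewrite eq_le (perp_cyl_le0 iu iv iu2 iv2 perp)/=.
pose u' x := -1 * u x; pose v' x := -1 * v x.
have iu' : integ mu u' by exact: integZ.
have iv' : integ mu v' by exact: integZ.
have sq (f : R * R -> R) : (fun x => (-1 * f x) ^+ 2) = (fun x => f x ^+ 2).
  by apply/funext => x; rewrite mulN1r sqrrN.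
have h : Ex mu (fun x => \1_(cyl s) x * u' x) <= 0.
  apply: (@perp_cyl_le0 u' v'); rewrite /u' /v' ?sq// => w; have [h1 h2] := perp w.
  have ip1 : integ mu (fun x => u x * cos (ang (lam w) x) - v x * sin (ang (lam w) x)).
    by apply: integB; apply: integM => //; [exact: bmeas_cos_ang|exact: bmeas_sin_ang].
  have ip2 : integ mu (fun x => u x * sin (ang (lam w) x) + v x * cos (ang (lam w) x)).
    by apply: integD; apply: integM => //; [exact: bmeas_sin_ang|exact: bmeas_cos_ang].
  split; [have := ExZ (-1) ip1; rewrite h1 mulr0 => <-|have := ExZ (-1) ip2; rewrite h2 mulr0 => <-];
    by apply: eq_Ex => x; ring.
have i1u : integ mu (fun x => \1_(cyl s) x * u x).
  rewrite (_ : (fun x => _) = (fun x => u x * \1_(cyl s) x)); last by apply/funext => x; rewrite mulrC.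
  by apply: integM => //; apply: bmeas_indic; exact: measurable_cyl.
have e : Ex mu (fun x => \1_(cyl s) x * u' x) = - Ex mu (fun x => \1_(cyl s) x * u x).
  by rewrite -mulN1r -ExZ//; apply: eq_Ex => x; rewrite /u'; ring.
by rewrite -oppr_le0 -e.
Qed.

Lemma lam_pad k w : lam (nseq k ord0 ++ w) = lam w.
Proof. by elim: k => //= k IH; rewrite lam0. Qed.

Lemma square_integ (f : R * R -> R) : measurable_fun setT f -> integ mu (fun x => f x ^+ 2) -> integ mu f.
Proof.
move=> mf if2.
apply: (@le_integrable _ _ _ mu setT measurableT _ (EFin \o (fun x => 1 + f x ^+ 2))).
- exact/measurable_EFinP.
- move=> x _ /=; rewrite lee_fin [leRHS]ger0_norm ?addr_ge0 ?sqr_ge0//.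
  by rewrite -[f x ^+ 2]real_normK ?num_real//; have := sqr_ge0 (`|f x| - 1); nra.
- by apply: integD => //; apply: bmeas_integ; exact: bmeas_cst.
Qed.

Lemma is_spectrum_lam : is_spectrum mu [set lam w | w in setT].
Proof.
split; last split.
- apply: (sub_countable (card_image_le _ _)); exact: countableP.
- move=> _ _ [w _ <-] [w' _ <-] ww'.
  pose k := maxn (size w) (size w').
  (* Orthogonality is known for words of equal length only, so both words are padded to the longer
     one. *)
  pose p (w : seq 'I_3) : seq 'I_3 := nseq (k - size w) ord0 ++ w.
  have sp x : (size x <= k)%N -> size (p x) = k by move=> h; rewrite size_cat size_nseq subnK.
  have pp : p w != p w'.
    by apply/eqP => e; apply: ww'; rewrite -(lam_pad (k - size w)) -(lam_pad (k - size w') w') -/(p w) e.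
  have [|h1 h2] := @power_eq0 (lam w - lam w').
    rewrite -(lam_pad (k - size w) w) -(lam_pad (k - size w') w').
    by apply: power_orth => //; rewrite -/(p w) -/(p w') !sp ?leq_maxl ?leq_maxr.
  split.
    by rewrite (integralEx (bmeas_integ mu (bmeas_cos_ang (lam w - lam w')))); congr EFin.
  by rewrite (integralEx (bmeas_integ mu (bmeas_sin_ang (lam w - lam w')))); congr EFin.
- move=> u v mu_ mv iu2 iv2 perp.
  have iu := square_integ mu_ iu2; have iv := square_integ mv iv2.
  have ip1 w : integ mu (fun x => u x * cos (ang (lam w) x) - v x * sin (ang (lam w) x)).
    by apply: integB; apply: integM => //; [exact: bmeas_cos_ang|exact: bmeas_sin_ang].
  have ip2 w : integ mu (fun x => u x * sin (ang (lam w) x) + v x * cos (ang (lam w) x)).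
    by apply: integD; apply: integM => //; [exact: bmeas_sin_ang|exact: bmeas_cos_ang].
  have perp' w : Ex mu (fun x => u x * cos (ang (lam w) x) - v x * sin (ang (lam w) x)) = 0 /\
      Ex mu (fun x => u x * sin (ang (lam w) x) + v x * cos (ang (lam w) x)) = 0.
    have [|h1 h2] := perp (lam w); first by exists w.
    by move: h1 h2; rewrite (integralEx (ip1 w)) (integralEx (ip2 w)) => -[->] [->].
  (* Multiplying [u + i v] by [-i] gives [v - i u], so the result on real parts also kills [v]. *)
  have perp2 w : Ex mu (fun x => v x * cos (ang (lam w) x) - (-1 * u x) * sin (ang (lam w) x)) = 0 /\
      Ex mu (fun x => v x * sin (ang (lam w) x) + (-1 * u x) * cos (ang (lam w) x)) = 0.
    have [h1 h2] := perp' w; split; first by rewrite -[RHS]h2; apply: eq_Ex => x; ring.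
    have := ExZ (-1) (ip1 w); rewrite h1 mulr0 => <-.
    by apply: eq_Ex => x; ring.
  have hu := perp_ae0 iu iv iu2 iv2 perp'.
  have hv : {ae mu, forall x, v x = 0}.
    apply: (perp_ae0 iv (integZ (-1) iu) iv2 _ perp2).
    rewrite (_ : (fun x => _) = (fun x => u x ^+ 2))//.
    by apply/funext => x; rewrite mulN1r sqrrN.
  by apply: filterS2 hu hv => x.
Qed.

End Spectrum.

(** * Good words, levels and the actual perturbation *)

Section TernaryWords.
Implicit Types (w u v : seq 'I_3) (d : 'I_3).

Lemma val3_cat b u v : val3 b (u ++ v) = b%:Z ^+ size v * val3 b u + val3 b v.
Proof.
elim: u => [|d u IH] /=; first by rewrite mulr0 add0r.
by rewrite IH size_cat exprD; ring.
Qed.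

Lemma val3_nseq0 b k w : val3 b (nseq k ord0 ++ w) = val3 b w.
Proof. by elim: k => //= k ->; rewrite /tau /= mul0r add0r. Qed.

Lemma tau_inj : injective tau.
Proof.
by move=> [[|[|[|//]]] i] [[|[|[|//]]] j] //= _; exact: val_inj.
Qed.

Lemma val3_half b w : (3 <= b)%N -> 2 * `|val3 b w| + 1 <= b%:Z ^+ size w.
Proof.
move=> b3; apply: le_trans (val3_bound w (leq_trans _ b3)) => //; rewrite lerD2r ler_wpM2r//.
by lia.
Qed.

(** The lower digits contribute less than half of [b^n], so the leading digit is forced. *)
Lemma val3_inj b w w' : (3 <= b)%N -> size w = size w' -> val3 b w = val3 b w' -> w = w'.
Proof.
move=> b3; elim: w w' => [|d w IH] [|d' w'] //= [sw] e.
have h := val3_half w b3; have h' := val3_half w' b3; rewrite -sw in h' e.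
have td : tau d = tau d'.
  have : (tau d - tau d') * b%:Z ^+ size w = val3 b w' - val3 b w by lia.
  set X := _ ^+ _ in h h' *; set k := tau d - _ => ek.
  have : `|k| * X < 1 * X.
    have X0 : 0 <= X by rewrite exprn_ge0.
    by rewrite -{1}(ger0_norm X0) -normrM ek; apply: (le_lt_trans (ler_normB _ _)); lia.
  by move=> H; have : `|k| < 1; [nia|lia].
rewrite (tau_inj td) (IH w' sw)//; move: e; rewrite td; lia.
Qed.

(** Equal values in base [b] mean equal words up to leading zeros. This passes from the second
    coordinate, in base [3 q2], to the first, in base [3 q1]. *)
Lemma val3_eq_base b b' u u' : (3 <= b)%N -> val3 b u = val3 b u' -> val3 b' u = val3 b' u'.
Proof.
move=> b3 e; pose k := maxn (size u) (size u').
have := @val3_inj b (nseq (k - size u) ord0 ++ u) (nseq (k - size u') ord0 ++ u') b3.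
rewrite !size_cat !size_nseq !val3_nseq0 !subnK ?leq_maxl ?leq_maxr// => /(_ erefl e) E.
by rewrite -(val3_nseq0 b' (k - size u)) E val3_nseq0.
Qed.

Definition reduced w := if w is d :: _ then d != ord0 else true.

Fixpoint strip w := if w is d :: w' then (if d == ord0 then strip w' else w) else [::].

Lemma reduced_strip w : reduced (strip w).
Proof. by elim: w => //= d w IH; case: ifPn. Qed.

Lemma val3_eq_reduced b w w' : (3 <= b)%N -> reduced w -> reduced w' ->
  val3 b w = val3 b w' -> w = w'.
Proof.
move=> b3; wlog sw : w w' / (size w <= size w')%N.
  move=> H rw rw' e; have [h|/ltnW h] := leqP (size w) (size w'); first exact: H.
  by apply/esym; apply: H.
move=> rw rw' e.
have E : nseq (size w' - size w) ord0 ++ w = w'.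
  by apply: (val3_inj b3); rewrite ?val3_nseq0// size_cat size_nseq subnK.
by case: (size w' - size w)%N E rw' => [|k] /= <-.
Qed.

(** Digits are raised to [1, 2, 3] in base [4], so that words of different lengths never share a
    code. *)
Fixpoint code w : nat := if w is d :: w' then (4 * code w' + d + 1)%N else 0%N.

Lemma code_inj : injective code.
Proof.
elim=> [|d w IH] [|d' w'] //=; try lia.
move=> e; have := ltn_ord d; have := ltn_ord d' => h' h.
have ed : d = d' :> nat by lia.
by rewrite (IH w'); [rewrite (val_inj ed)|lia].
Qed.

Lemma size_code w : (size w <= code w)%N.
Proof. by elim: w => //= d w IH; lia. Qed.

Variable J : pred nat.

Fixpoint good w := if w is d :: w' then ((d == ord0) || J (size w')) && good w' else true.

Lemma good_cat u v : good (u ++ v) -> good v.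
Proof. by elim: u => //= d u IH /andP[_]. Qed.

Lemma good_nseq0 k w : good (nseq k ord0 ++ w) = good w.
Proof. by elim: k. Qed.

Fixpoint gwords n : seq (seq 'I_3) :=
  if n is n'.+1 then
    (if J n' then [seq d :: w | d <- enum 'I_3, w <- gwords n'] else [seq ord0 :: w | w <- gwords n'])
  else [:: [::]].

Lemma mem_gwords n w : (w \in gwords n) = (size w == n) && good w.
Proof.
elim: n w => [|n IH] w /=; first by case: w => [|d w]; rewrite inE.
case: ifP => Jn; last first.
  apply/mapP/andP => [[w' hw' ->]|].
    by move: hw'; rewrite IH => /andP[/eqP <- gw] /=; rewrite eqxx gw.
  case: w => [|d w] [] //= /eqP[sw]; rewrite sw Jn orbF => /andP[/eqP -> gw].
  by exists w => //; rewrite IH sw eqxx.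
apply/allpairsP/andP => [[[d w'] /= [_ hw' ->]]|].
  by move: hw'; rewrite IH => /andP[/eqP sw gw] /=; rewrite sw eqxx gw Jn orbT.
case: w => [|d w] [] //= /eqP[sw] /andP[_ gw].
by exists (d, w); rewrite mem_enum IH sw eqxx.
Qed.

Lemma uniq_gwords n : uniq (gwords n).
Proof.
elim: n => //= n IH; case: ifP => _.
  by apply: allpairs_uniq => //; [exact: enum_uniq|move=> [d w] [d' w'] _ _ /= [-> ->]].
by rewrite map_inj_uniq// => w w' [].
Qed.

Lemma size_gwords n : size (gwords n) = (3 ^ count J (iota 0 n))%N.
Proof.
elim: n => // n IH.
have -> : count J (iota 0 n.+1) = (count J (iota 0 n) + J n)%N.
  by rewrite -[n.+1]addn1 iotaD count_cat /= addn0.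
rewrite [gwords _]/=; case: ifP => _; rewrite ?size_allpairs ?size_map ?size_enum_ord IH; last by rewrite addn0.
by rewrite -enumT size_enum_ord addn1 expnS.
Qed.

Variables (b : nat) (eps : nat -> bool).

(** The factor [4] leaves room for the bit [eps] without breaking injectivity, and lifts the level
    at least two above the length, so that [b ^ level w] dominates the rest of the frequency. *)
Definition level w : nat := (4 * code w + eps (size w))%N.

(* Bad words carry a single huge term [b ^ level w]; reducing the earlier part of
   [sig] modulo [b ^ size w] discards the huge terms of the suffixes of [w]. *)
Fixpoint sig w : nat :=
  if w is d :: w' then
    if d == ord0 then sig w' else
    if good w then 0%N else (sig w' %% b ^ (size w').+1 + b ^ level w)%N
  else 0%N.

Lemma sig_good w : good w -> sig w = 0%N.
Proof. by elim: w => //= d w IH g; rewrite g; case: ifP => // _; apply: IH; case/andP: g. Qed.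

(** The added power is a multiple of the modulus because a level is at least the length of its word;
    for a good word both sides are [0]. *)
Lemma sig_mod d w : (sig (d :: w) = sig w %[mod b ^ (size w).+1])%N.
Proof.
rewrite [sig (d :: w)]/=; case: ifP => // _; case: ifP => [g|_].
  by rewrite sig_good//; case/andP: g.
have sl : ((size w).+1 <= level (d :: w))%N by have := size_code (d :: w); rewrite /level /=; lia.
by rewrite -(subnK sl) expnD addnC modnMDl modn_mod.
Qed.

Lemma level_inj w w' : level w = level w' -> w = w'.
Proof.
move=> e; apply: code_inj; move: e; rewrite /level.
by case: (eps (size w)); case: (eps (size w')); lia.
Qed.

Lemma size_level w : w != [::] -> (size w + 2 <= level w)%N.
Proof. by case: w => //= d w _; have := size_code w; rewrite /level /=; lia. Qed.

Hypothesis b0 : (0 < b)%N.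

Lemma sig_bad w : reduced w -> ~~ good w ->
  exists2 r, (r < b ^ size w)%N & sig w = (r + b ^ level w)%N.
Proof.
case: w => // d w /= dn0 gw; exists (sig w %% b ^ (size w).+1)%N.
  by rewrite ltn_mod expn_gt0 b0.
by move: gw; rewrite (negbTE dn0)/= => /negbTE ->.
Qed.

Lemma sig_form w : exists2 r, (r < b ^ size w)%N &
  sig w = r \/ exists M, sig w = (r + b ^ M)%N.
Proof.
elim: w => [|d w [r hr IH]]; first by exists 0%N; [rewrite expn_gt0 b0|left].
have [->|dn0] := eqVneq d ord0.
  by exists r => //=; apply: (leq_trans hr); rewrite leq_pexp2l.
have [g|g] := boolP (good (d :: w)).
  by exists 0%N; [rewrite expn_gt0 b0|left; exact: sig_good].
have [r' hr' e] := @sig_bad (d :: w) dn0 g.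
by exists r' => //; right; exists (level (d :: w)).
Qed.

End TernaryWords.

(** * Bounding the cardinality of a planar set *)

Section Ecard.
Context (R : realType).
Implicit Types S : set (R * R).

(** A right-sided inverse of the code [f], chosen by [xget], lists [S]; this gives finiteness and
    the bound at once. *)
Lemma ecard_le S (T : eqType) (f : R * R -> T) (L : seq T) :
  (forall p, S p -> f p \in L) ->
  (forall p p', S p -> S p' -> f p = f p' -> p = p') ->
  (ecard S <= (size L)%:R%:E)%E.
Proof.
move=> fL finj.
pose g t := xget (0, 0) [set p | S p /\ f p = t].
have gf p : S p -> g (f p) = p.
  move=> Sp; have [h1 h2] : [set p' | S p' /\ f p' = f p] (g (f p)).
    by apply: xgetPex; exists p.
  exact: finj.
have sub : S `<=` [set` map g L].
  by move=> p Sp; rewrite /= -(gf p Sp); apply: map_f; exact: fL.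
have finS : finite_set S by apply: sub_finite_set sub _; exact: finite_seq.
rewrite /ecard; case: pselect => // h; rewrite lee_fin ler_nat -(size_map g L).
apply: uniq_leq_size; first exact: fset_uniq.
move=> p hp; apply: sub; have : p \in fset_set S by [].
by rewrite in_fset_set// inE.
Qed.

Lemma ecard_ge S (P : seq (R * R)) : uniq P -> (forall p, p \in P -> S p) ->
  ((size P)%:R%:E <= ecard S)%E.
Proof.
move=> uP PS; rewrite /ecard; case: pselect => h; last exact: leey.
rewrite lee_fin ler_nat; apply: uniq_leq_size => // p /PS Sp.
suff : p \in fset_set S by [].
by rewrite in_fset_set// inE.
Qed.

End Ecard.

(** * Counting frequencies in balls of radius about [b^M] *)

Section Counting.
Context (R : realType) (q1 q2 : nat) (hq1 : (1 <= q1)%N) (hq12 : (q1 <= q2)%N).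
Variables (J : pred nat) (eps : nat -> bool).
Let b := (3 * q2)%N.
Notation sg := (sig J b eps).
Notation LM := (lam R q1 q2 sg).
Notation LM1 := (lam1 q1).
Notation LM2 := (lam2 q2 sg).

Definition Lam : set (R * R) := [set LM w | w in setT].

Let hq2 : (1 <= q2)%N. Proof. exact: leq_trans hq1 hq12. Qed.
Let b3 : (3 <= b)%N. Proof. by rewrite /b; lia. Qed.
Let a3 : (3 <= 3 * q1)%N. Proof. by lia. Qed.

Lemma lam_strip w : LM (strip w) = LM w.
Proof. by elim: w => //= d w IH; case: eqP => // ->; rewrite lam0. Qed.

Definition word_of p := strip (xget [::] [set w | LM w = p]).

Lemma lam_word_of p : Lam p -> LM (word_of p) = p.
Proof. by move=> [w _ e]; rewrite lam_strip; have : [set w | LM w = p] w by []; exact: xgetI. Qed.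

Lemma eball_snd (x p : R * R) h : eball x h p -> `|p.2 - x.2| < h.
Proof.
rewrite /eball /=; apply: le_lt_trans.
by rewrite -sqrtr_sqr ler_wsqrtr// lerDr sqr_ge0.
Qed.

Lemma lam2_close x h M w w' : h <= b%:R ^+ M -> eball x h (LM w) -> eball x h (LM w') ->
  `|LM2 w - LM2 w'| < 2 * b%:Z ^+ M.
Proof.
move=> hM /eball_snd h1 /eball_snd h2; rewrite -(ltr_int R) intr_norm rmorphB /= intrM rmorphXn /=.
rewrite -[(b%:Z)%:~R]/(b%:R : R); move: h1 h2; rewrite /= => h1 h2.
have -> : (LM2 w)%:~R - (LM2 w')%:~R = ((LM2 w)%:~R - x.2) - ((LM2 w')%:~R - x.2) :> R by ring.
apply: (le_lt_trans (ler_normB _ _)); lra.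
Qed.

(** Padding guarantees at least [M] digits, so that the cut into [upper] and [lower] always leaves
    exactly [M] low digits. *)
Definition padded M (w : seq 'I_3) := nseq (M - size w) ord0 ++ w.
Definition upper M w := take (size (padded M w) - M) (padded M w).
Definition lower M w := drop (size (padded M w) - M) (padded M w).

Lemma val3_upper_lower c M w :
  val3 c w = c%:Z ^+ M * val3 c (upper M w) + val3 c (lower M w) /\ size (lower M w) = M.
Proof.
have sl : size (lower M w) = M.
  rewrite size_drop subKn// /padded size_cat size_nseq; lia.
split => //; rewrite -{1}sl -val3_cat cat_take_drop; exact/esym/val3_nseq0.
Qed.

Lemma good_lower M w : good J w -> good J (lower M w).
Proof.
move=> g; apply: (@good_cat _ (upper M w)).
by rewrite cat_take_drop good_nseq0.
Qed.

(* Within a ball of radius [b ^ M] the upper parts differ by less than [3], so their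
   residues modulo [4] determine them. *)
Lemma good_inj M w w' : good J w -> good J w' -> `|LM2 w - LM2 w'| < 2 * b%:Z ^+ M ->
  (val3 b (upper M w) = val3 b (upper M w') %[mod 4])%Z -> lower M w = lower M w' ->
  LM w = LM w'.
Proof.
move=> gw gw' close e low.
have [E s] := val3_upper_lower b M w; have [E' s'] := val3_upper_lower b M w'.
have ek : val3 b (upper M w) = val3 b (upper M w').
  have h1 := qval3_half (lower M w) hq2; have h2 := qval3_half (lower M w') hq2.
  rewrite s -/b in h1; rewrite s' -/b in h2.
  move: close; rewrite /lam2 !sig_good// E E'.
  move: e; set k := val3 b _; set k' := val3 b _; set X := _ ^+ M in h1 h2 *.
  set v := val3 b _ in h1 *; set v' := val3 b _ in h2 * => e close.
  have X0 : 0 < X by rewrite exprn_gt0//; lia.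
  have : `|k - k'| < 3.
    have : `|q2%:Z * ((k - k') * X)| < 3 * X.
      have -> : q2%:Z * ((k - k') * X) = - (0%N%:Z - q2%:Z * (X * k + v) - (0%N%:Z - q2%:Z * (X * k' + v')))
        - (q2%:Z * v - q2%:Z * v') by ring.
      apply: (le_lt_trans (ler_normB _ _)); rewrite normrN.
      by have := ler_normB (q2%:Z * v) (q2%:Z * v'); lia.
    rewrite !normrM [ `|X|]gtr0_norm// [ `|q2%:Z|]ger0_norm// => H.
    rewrite -(ltr_pM2r X0); apply: le_lt_trans H; rewrite -[leLHS]mul1r ler_wpM2r//.
    by rewrite mulr_ge0// (ltW X0).
  by lia.
rewrite /lam /lam1 /lam2 !sig_good// E E' ek low; congr (_%:~R, _).
have [-> _] := val3_upper_lower (3 * q1) M w; have [-> _] := val3_upper_lower (3 * q1) M w'.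
by rewrite low (val3_eq_base _ b3 ek).
Qed.

(** At a level of [M + 2] or more, [b ^ level w] exceeds the sum of all other terms and of [2 b^M].
    So a ball contains at most one bad word of such a level. *)
Lemma bad_level M w w' : reduced w -> reduced w' -> ~~ good J w -> ~~ good J w' ->
  `|LM2 w - LM2 w'| < 2 * b%:Z ^+ M ->
  (level eps w' < level eps w)%N -> (level eps w < M + 2)%N.
Proof.
move=> rw rw' gw gw' close lv; rewrite ltnNge; apply/negP => big.
have b0 : (0 < b)%N by apply: leq_trans b3.
have [r hr e] := sig_bad eps b0 rw gw; have [r' hr' e'] := sig_bad eps b0 rw' gw'.
have h1 := qval3_half w hq2; have h2 := qval3_half w' hq2; rewrite -/b in h1 h2.
have nz v : ~~ good J v -> v != [::] by case: v.
have pw m n : (m <= n)%N -> (b ^ m <= b ^ n)%N by move=> mn; rewrite leq_pexp2l.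
have p2 m : (9 * b ^ m <= b ^ (m + 2))%N by rewrite expnD mulnC leq_mul2l; apply/orP; right; nia.
have p1 m : (3 * b ^ m <= b ^ m.+1)%N by rewrite expnS leq_mul2r b3 orbT.
have k1 := leq_trans (p2 (size w)) (pw _ _ (size_level eps (nz _ gw))).
have k2 := leq_trans (p2 (size w')) (pw _ _ (size_level eps (nz _ gw'))).
have k3 := leq_trans (p1 _) (pw _ _ lv).
have k4 := leq_trans (p2 M) (pw _ _ big).
move: close; rewrite /lam2 e e' !PoszD.
have X n : b%:Z ^+ n = (b ^ n)%N%:Z by rewrite -[RHS]natz natrX natz.
rewrite !X in h1 h2 *; move: hr hr' h1 h2 k1 k2 k3 k4.
move: (b ^ size w)%N (b ^ size w')%N (b ^ level eps w)%N (b ^ level eps w')%N (b ^ M)%N.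
move: (q2%:Z * val3 b w) (q2%:Z * val3 b w') => *; lia.
Qed.

Lemma card_upper M x h : h <= b%:R ^+ M ->
  (ecard (Lam `&` eball x h) <= (4 * 3 ^ count J (iota 0 M) + (M + 3))%:R%:E)%E.
Proof.
move=> hM.
pose f p : (nat * seq 'I_3) + nat :=
  let w := word_of p in
  if good J w then inl (`|(val3 b (upper M w) %% 4)%Z|%N, lower M w)
  (* All levels from [M + 2] on share one code, which is harmless as at most one of them occurs;
     hence [M + 3] codes for bad words. *)
  else inr (minn (level eps w) (M + 2)).
pose L : seq ((nat * seq 'I_3) + nat) :=
  [seq inl (i, w) | i <- iota 0 4, w <- gwords J M] ++ [seq inr n | n <- iota 0 (M + 3)].
have -> : (4 * 3 ^ count J (iota 0 M) + (M + 3))%N = size L.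
  by rewrite size_cat size_allpairs size_map !size_iota size_gwords.
apply: (@ecard_le _ _ _ f).
  move=> p [Lp _]; rewrite /f mem_cat; case: ifP => g; apply/orP; [left|right].
    apply/allpairsP; exists (`|(val3 b (upper M (word_of p)) %% 4)%Z|%N, lower M (word_of p)).
    split => //; last by rewrite mem_gwords good_lower// (val3_upper_lower b M _).2 eqxx.
    by rewrite mem_iota /=; lia.
  by apply: map_f; rewrite mem_iota /=; lia.
move=> p p' [Lp Bp] [Lp' Bp'].
have Ep := lam_word_of Lp; have Ep' := lam_word_of Lp'.
have close : `|LM2 (word_of p) - LM2 (word_of p')| < 2 * b%:Z ^+ M.
  by apply: (lam2_close hM (x := x)); rewrite ?Ep ?Ep'.
rewrite /f; case: ifPn => g; case: ifPn => g' //.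
  move=> [e1 e2]; rewrite -Ep -Ep'; apply: good_inj close _ e2 => //; lia.
have rp := reduced_strip (xget [::] [set w | LM w = p]); rewrite -/(word_of p) in rp.
have rp' := reduced_strip (xget [::] [set w | LM w = p']); rewrite -/(word_of p') in rp'.
move=> [e]; rewrite -Ep -Ep'.
have [lt|lt|/level_inj -> //] := ltngtP (level eps (word_of p)) (level eps (word_of p')).
  have := bad_level rp' rp g' g _ lt; rewrite distrC => /(_ _ close); lia.
have := bad_level rp rp' g g' close lt; lia.
Qed.

(** Good words of length [M] are unperturbed, so both coordinates are at most [b^M / 2], the first
    because [q1 <= q2]; their norm is then strictly below [b^M]. *)
Lemma card_lower M (h : R) : b%:R ^+ M <= h ->
  ((3 ^ count J (iota 0 M))%:R%:E <= ecard (Lam `&` eball (0%R, 0%R) h))%E.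
Proof.
move=> hM; rewrite -size_gwords -(size_map LM); apply: ecard_ge.
  rewrite map_inj_in_uniq ?uniq_gwords// => w w'; rewrite !mem_gwords => /andP[/eqP sw _] /andP[/eqP sw' _].
  move=> [/eqP]; rewrite eqr_int /lam1 => /eqP e _.
  apply: (val3_inj a3); first by rewrite sw sw'.
  by apply: (@mulfI _ q1%:Z) => //; lia.
move=> _ /mapP[w hw ->]; split; first by exists w.
move: hw; rewrite mem_gwords => /andP[/eqP sw gw].
have bM : 0 < b%:R ^+ M :> R by rewrite exprn_gt0// ltr0n; lia.
have H1 : `|(LM w).1| <= b%:R ^+ M / 2.
  have := qval3_half w hq1; rewrite -/(LM1 w) sw => H.
  have H' : 2 * `|LM1 w| <= b%:Z ^+ M.
    by apply: (le_trans H); rewrite lerXn2r ?nnegrE// /b; lia.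
  have : (2 * `|LM1 w|)%:~R <= (b%:Z ^+ M)%:~R :> R by rewrite ler_int.
  by rewrite intrM rmorphXn /= intr_norm -[(b%:Z)%:~R]/(b%:R : R); lra.
have H2 : `|(LM w).2| <= b%:R ^+ M / 2.
  have := qval3_half w hq2; rewrite -/b sw => H.
  have : (2 * `|LM2 w|)%:~R <= (b%:Z ^+ M)%:~R :> R.
    by rewrite ler_int /lam2 sig_good// sub0r normrN.
  by rewrite intrM rmorphXn /= intr_norm -[(b%:Z)%:~R]/(b%:R : R); lra.
change (is_true (Num.sqrt (((LM w).1 - 0) ^+ 2 + ((LM w).2 - 0) ^+ 2) < h)); rewrite !subr0.
have h0 : 0 < h by apply: lt_le_trans hM.
rewrite -[ltRHS]gtr0_norm// -sqrtr_sqr ltr_sqrt ?exprn_gt0//.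
rewrite -[(LM w).1 ^+ 2]real_normK ?num_real// -[(LM w).2 ^+ 2]real_normK ?num_real//.
have := normr_ge0 (LM w).1; have := normr_ge0 (LM w).2.
move: H1 H2; set y1 := `|_|; set y2 := `|_|; set z := b%:R ^+ M in hM bM * => H1 H2 y20 y10.
by nra.
Qed.

End Counting.

(** * From counting bounds to the Beurling dimension *)

Section Dimension.
Context (R : realType) (L : set (R * R)) (b : nat) (c : nat -> nat) (t theta : R).
Hypothesis b3 : (3 <= b)%N.
Hypothesis t0 : 0 <= t.
Hypothesis thetaE : theta * ln 3 = t * ln b%:R.
(** [c M.+1] will be the integer part of [theta M]; the index is shifted because position [0] is not
    in [J]. *)
Hypothesis c_le : forall M, (c M.+1)%:R <= theta * M%:R.
Hypothesis c_ge : forall M, theta * M%:R - 1 <= (c M.+1)%:R.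
Hypothesis upper_count : forall M x h, h <= b%:R ^+ M ->
  (ecard (L `&` eball x h) <= (4 * 3 ^ c M + (M + 3))%:R%:E)%E.
Hypothesis lower_count : forall M (h : R), b%:R ^+ M <= h ->
  ((3 ^ c M)%:R%:E <= ecard (L `&` eball (0%R, 0%R) h))%E.

Let bR : 3 <= b%:R :> R. Proof. by rewrite ler_nat. Qed.
Let bp : 0 < b%:R :> R. Proof. by rewrite ltr0n; apply: leq_trans b3. Qed.

Lemma ecard_ge0 (S : set (R * R)) : (0 <= ecard S)%E.
Proof. by rewrite /ecard; case: pselect => // _; rewrite lee_fin. Qed.

Lemma sup_density_ge0 r (h : R) : (0 <= sup_density L r h)%E.
Proof.
apply: (@le_trans _ _ (ecard (L `&` eball (0%R, 0%R) h) * ((h `^ r)^-1)%:E)%E).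
  by rewrite mule_ge0 ?ecard_ge0// lee_fin invr_ge0 powR_ge0.
by apply: ereal_sup_ubound; exists (0, 0).
Qed.

Lemma powR_expR (x y : R) : 0 < x -> x `^ y = expR (y * ln x).
Proof. by move=> x0; rewrite /powR gt_eqF. Qed.

Lemma pow3_theta (x : R) : 3 `^ (theta * x) = (b%:R `^ x) `^ t.
Proof.
rewrite -powRrM !powR_expR//; congr expR.
by rewrite mulrAC thetaE; ring.
Qed.

Lemma log_bracket h : 1 <= h -> exists M, b%:R ^+ M <= h /\ h < b%:R ^+ M.+1 :> R.
Proof.
move=> h1; pose P n := h < b%:R ^+ n :> R.
have exP : exists n, P n.
  exists (Num.bound h); rewrite /P; have := archi_boundP (le_trans ler01 h1) => hb.
  apply: (lt_le_trans hb); rewrite -natrX ler_nat ltnW// ltn_expl//.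
  by apply: leq_trans b3.
case: (ex_minnP exP) => -[|M]; rewrite {1}/P => hM min; first by move: hM; rewrite expr0; lra.
exists M; split => //; rewrite leNgt; apply/negP => h2.
by have := min M h2; rewrite ltnn.
Qed.

(** The linear contribution of the bad words is absorbed by [h^a], as
    [M ln b <= ln h <= h^a / a]. *)
Lemma count_pow a : 0 < a -> exists2 K, 0 < K & forall x h, 1 <= h ->
  (ecard (L `&` eball x h) <= (K * h `^ (t + a))%:E)%E.
Proof.
move=> a0.
have lb : 0 < ln b%:R :> R by apply: ln_gt0; apply: lt_le_trans bR; rewrite ltr1n.
(* At [M + 1] the count is [4 * 3^c + M + 4]: the [8] covers the two fours and the inverse covers
   [M]. *)
pose K := 8 + (a * ln b%:R)^-1.
have Ki : 0 < (a * ln b%:R)^-1 by rewrite invr_gt0 mulr_gt0.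
exists K; first by rewrite /K; lra.
move=> x h h1; have [M [hM1 hM2]] := log_bracket h1.
have h0 : 0 < h by lra.
apply: (le_trans (upper_count x (ltW hM2))); rewrite lee_fin natrD natrM natrX.
set A := h `^ (t + a).
have A1 : 1 <= A by rewrite -(powRr0 h) ler_powR// addr_ge0// ltW.
have At : h `^ t <= A by rewrite ler_powR// lerDl ltW.
have Aa : h `^ a <= A by rewrite ler_powR// lerDr.
have c3 : 3 ^+ c M.+1 <= h `^ t.
  rewrite -powR_mulrn//; apply: (@le_trans _ _ (3 `^ (theta * M%:R))).
    by apply: ler_powR => //; rewrite ler1n.
  rewrite pow3_theta powR_mulrn; last exact: ltW.
  by apply: ge0_ler_powR => //; rewrite nnegrE ?exprn_ge0 ?(ltW bp)// ltW.
have cM : M%:R <= (a * ln b%:R)^-1 * h `^ a.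
  rewrite -ler_pdivrMl ?invr_gt0 ?mulr_gt0// invrK.
  have l1 : M%:R * ln b%:R <= ln h.
    by rewrite mulrC mulr_natr -lnXn// ler_ln ?posrE ?exprn_gt0.
  have l2 : a * ln h <= h `^ a.
    by rewrite -ln_powR ltW// ln_sublinear// powR_gt0.
  by apply: le_trans l2; rewrite -mulrA ler_pM2l// mulrC.
have : (a * ln b%:R)^-1 * h `^ a <= (a * ln b%:R)^-1 * A by rewrite ler_pM2l.
rewrite /K natrD -natr1; lra.
Qed.

Lemma density_above r : t < r -> upper_beurling_density L r = 0%E.
Proof.
move=> tr; apply/eqP; rewrite eq_le; apply/andP; split; last first.
  apply: le_ereal_inf_tmp => _ [M _ <-].
  apply: (@le_trans _ _ (sup_density L r (M + 1))); first exact: sup_density_ge0.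
  by apply: ereal_sup_ubound; exists (M + 1) => //=; rewrite ltrDl.
pose a := (r - t) / 2; have a0 : 0 < a by rewrite /a; lra.
have [K K0 hK] := count_pow a0.
apply/lee_addgt0Pr => e e0; rewrite add0e.
(* Beyond [(K / e)^(1/a)] the spare factor [h^a] makes [K h^(r - a)] at most [e h^r]. *)
pose H := 1 + (K / e) `^ a^-1.
have Ke : 0 < K / e by rewrite divr_gt0.
have H1 : 1 <= H by rewrite /H lerDl powR_ge0.
apply: (@le_trans _ _ (ereal_sup [set sup_density L r h | h in [set h | H < h]])).
  by apply: ereal_inf_lbound; exists H => //=; lra.
apply: ge_ereal_sup => _ [h /= Hh <-]; apply: ge_ereal_sup => _ [x _ <-].
have h1 : 1 <= h by lra.
have h0 : 0 < h by lra.
have hr : 0 < h `^ r by exact: powR_gt0.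
apply: (@le_trans _ _ ((K * h `^ (t + a))%:E * ((h `^ r)^-1)%:E)%E).
  by apply: lee_wpmul2r; [rewrite lee_fin invr_ge0 ltW|exact: hK].
rewrite -EFinM lee_fin ler_pdivrMr//.
have -> : r = (t + a) + a by rewrite /a; lra.
have n0 : h != 0 by rewrite gt_eqF.
rewrite [h `^ (t + a + a)]powRD; last by rewrite n0 implybT.
rewrite mulrCA mulrC ler_wpM2l ?powR_ge0// -ler_pdivrMl// mulrC.
have -> : K / e = ((K / e) `^ a^-1) `^ a by rewrite -powRrM mulVf ?gt_eqF// powRr1// ltW.
by apply: ge0_ler_powR => //; rewrite ?nnegrE ?powR_ge0 ?ltW//; rewrite /H in Hh; lra.
Qed.

Lemma density_below r : 0 < r -> r < t -> upper_beurling_density L r <> 0%E.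
Proof.
move=> r0 rt e; have : (1 <= upper_beurling_density L r)%E; last by rewrite e lee_fin; lra.
apply: le_ereal_inf_tmp => _ [M0 /= M00 <-].
(* The second bound gives [t m - 1 >= r (m + 1)], so that [3^(theta m - 1)] is at least [h^r] at
   [h = b^(m+1)]. *)
pose m := maxn (Num.bound M0) (Num.bound ((1 + r) / (t - r))).
have m1 : M0 < m%:R.
  by apply: (lt_le_trans (archi_boundP (ltW M00))); rewrite ler_nat leq_maxl.
have m2 : 1 + r <= m%:R * (t - r).
  rewrite -ler_pdivrMr; last by lra.
  have p : 0 <= (1 + r) / (t - r) by rewrite divr_ge0; lra.
  by apply: (le_trans (ltW (archi_boundP p))); rewrite ler_nat leq_maxr.
pose h : R := b%:R ^+ m.+1.
have hM : M0 < h.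
  apply: (lt_trans m1); rewrite /h -natrX ltr_nat; apply: (@leq_trans (b ^ m)).
    by apply: ltn_expl; apply: leq_trans b3.
  by rewrite leq_pexp2l//; apply: leq_trans b3.
have h0 : 0 < h by rewrite exprn_gt0.
apply: (@le_trans _ _ (sup_density L r h)); last by apply: ereal_sup_ubound; exists h.
apply: (@le_trans _ _ (ecard (L `&` eball (0%R, 0%R) h) * ((h `^ r)^-1)%:E)%E); last first.
  by apply: ereal_sup_ubound; exists (0, 0).
have hr : 0 < h `^ r by exact: powR_gt0.
apply: (@le_trans _ _ ((3 ^ c m.+1)%:R%:E * ((h `^ r)^-1)%:E)%E); last first.
  by apply: lee_wpmul2r; [rewrite lee_fin invr_ge0 ltW|exact: lower_count].
rewrite -EFinM lee_fin ler_pdivlMr// mul1r natrX -powR_mulrn//.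
apply: (@le_trans _ _ (3 `^ (theta * m%:R - 1))); last by apply: ler_powR => //; rewrite ler1n.
have lb : 0 < ln b%:R :> R by apply: ln_gt0; apply: lt_le_trans bR; rewrite ltr1n.
have l3 : ln 3 <= ln b%:R :> R by rewrite ler_ln ?posrE.
rewrite /h -powR_mulrn ?(ltW bp)// -powRrM !powR_expR// ler_expR mulrBl [theta * _ * _]mulrAC thetaE mul1r -natr1.
have := ler_wpM2r (ltW lb) m2; lra.
Qed.

Lemma beurling_dim_counts : beurling_dim L = t%:E.
Proof.
apply/eqP; rewrite eq_le; apply/andP; split.
  apply/lee_addgt0Pr => e e0; apply: ereal_inf_lbound; exists (t + e) => //=.
  by split; [rewrite ltr_wpDl|apply: density_above; rewrite ltrDl].
apply: le_ereal_inf_tmp => _ [r [r0 hr] <-]; rewrite lee_fin leNgt; apply/negP => rt.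
exact: (density_below r0 rt).
Qed.

End Dimension.

(** * Uncountably many choices of the free bits *)

Section Family.
Context (R : realType) (q1 q2 : nat) (hq1 : (1 <= q1)%N) (hq12 : (q1 <= q2)%N).
Variable J : pred nat.
Hypothesis J0 : ~~ J 0.
Let b := (3 * q2)%N.

(** The word [1 0^k 1] is bad, as its last digit sits at position [0]. The unperturbed first
    coordinate identifies it within either set; equality of the second coordinates then compares the
    levels, hence the bits at length [k + 2]. *)
Lemma Lam_inj_eps (eps eps' : nat -> bool) :
  Lam (R := R) q1 q2 J eps = Lam (R := R) q1 q2 J eps' -> forall k, eps k.+2 = eps' k.+2.
Proof.
move=> E k; pose w : seq 'I_3 := inord 1 :: nseq k ord0 ++ [:: inord 1].
have i1 : (inord 1 : 'I_3) != ord0 by apply/eqP => /(congr1 val) /=; rewrite inordK.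
have sw : size w = k.+2 by rewrite /= size_cat size_nseq addn1.
have rw : reduced w by [].
have gw : ~~ good J w.
  by apply/negP => /= /andP[_]; rewrite good_nseq0 /= (negbTE i1) (negbTE J0).
have b3 : (3 <= b)%N by rewrite /b; lia.
have b0 : (0 < b)%N by apply: leq_trans b3.
have : Lam (R := R) q1 q2 J eps' (lam R q1 q2 (sig J b eps) w) by rewrite -E; exists w.
move=> [w0 _]; rewrite -lam_strip; set w' := strip w0 => -[/eqP e1 /eqP e2].
have ww' : w' = w.
  apply: (@val3_eq_reduced (3 * q1)) => //; [by lia|exact: reduced_strip|].
  by move: e1; rewrite eqr_int /lam1 => /eqP; apply: mulfI; lia.
move: e2; rewrite ww' eqr_int /lam2 => /eqP /addIr E2.
have {E2} : sig J b eps' w = sig J b eps w by case: E2.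
have [r hr ->] := sig_bad eps b0 rw gw; have [r' hr' ->] := sig_bad eps' b0 rw gw.
have wn : w != [::] by [].
have big e : (b ^ size w <= b ^ level e w)%N.
  by rewrite leq_pexp2l//; have := size_level e wn; lia.
(* The value lies in [[b^level, 2 b^level)] and [b >= 3], so it determines the level. *)
have key e e' s s' : (s < b ^ size w)%N -> (s + b ^ level e w = s' + b ^ level e' w)%N ->
    (level e' w <= level e w)%N.
  move=> hs H; rewrite leqNgt; apply/negP => lt.
  have : (3 * b ^ level e w <= b ^ level e' w)%N.
    by apply: (@leq_trans (b ^ (level e w).+1)); [rewrite expnS leq_mul2r b3 orbT|rewrite leq_pexp2l].
  by have := big e; lia.
move=> H; have h1 := key _ _ _ _ hr' H; have h2 := key _ _ _ _ hr (esym H).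
have : level eps w = level eps' w by apply/eqP; rewrite eqn_leq h1 h2.
by rewrite /level sw; case: (eps k.+2); case: (eps' k.+2) => //; lia.
Qed.

End Family.

(** Telescoping of unit jumps; at [k = 0] the convention [0.-1 = 0] rules out a jump. *)
Lemma count_jumps (f : nat -> nat) : f 0 = 0%N ->
  (forall k, (f k <= f k.+1 <= (f k).+1)%N) ->
  forall M, count (fun k => f k.-1 < f k)%N (iota 0 M.+1) = f M.
Proof.
move=> f0 fS; elim=> [|M IH]; first by rewrite /= ltnn f0.
rewrite -[M.+2]addn1 iotaD count_cat IH /= add0n addn0.
by have := fS M; case: ltnP => ?; lia.
Qed.

(** Cantor's diagonal: [D] disagrees with every [e] at the index that the supposed enumeration gives
    to [F e]. *)
Lemma uncountable_family (T : Type) (X : set T) (F : (nat -> bool) -> T) :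
  (forall e, X (F e)) -> (forall e e', F e = F e' -> e =1 e') -> ~ countable X.
Proof.
move=> XF Finj /countable_injP[f finj].
pose D n := `[< exists e, f (F e) = n /\ e n = false >].
have [|nD] := boolP (D (f (F D))).
  move=> /[dup] Dt /asboolP[e [fe en]].
  have /Finj eD : F e = F D by apply: finj => //; rewrite inE.
  by rewrite -eD en in Dt.
by move: (nD) => /asboolP; apply; exists D; split => //; exact: negbTE.
Qed.

Theorem theorem1p4 (R : realType) (q1 q2 : nat) (hq1 : (1 <= q1)%N) (hq12 : (q1 <= q2)%N)
  (mu : probability (R * R)%type R) (hmu : is_sierpinski_measure q1 q2 mu)
  (t : R) (ht0 : 0 <= t) (ht1 : t <= ln 3 / ln (3 * q2%:R)) :
  ~ countable [set Lam : set (R * R) | is_spectrum mu Lam /\ beurling_dim Lam = t%:E].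
Proof.
have hq2 : (1 <= q2)%N by apply: leq_trans hq12.
pose b := (3 * q2)%N.
have b3 : (3 <= b)%N by rewrite /b; lia.
have b0 : (0 < b)%N by apply: leq_trans b3.
have bE : b%:R = 3 * q2%:R :> R by rewrite natrM.
have l3 : 0 < ln 3 :> R by apply: ln_gt0; rewrite ltr1n.
have lb : 0 < ln b%:R :> R by apply: ln_gt0; rewrite ltr1n; apply: leq_trans b3.
pose theta := t * ln b%:R / ln 3.
have thetaE : theta * ln 3 = t * ln b%:R by rewrite mulfVK// gt_eqF.
have th0 : 0 <= theta by rewrite divr_ge0 ?mulr_ge0// ltW.
have th1 : theta <= 1.
  by rewrite ler_pdivrMr// mul1r -ler_pdivlMr// bE.
(* Since [0 <= theta <= 1], these integer parts increase by [0] or [1]; [J] collects the places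
   where they jump, which gives it density [theta]. *)
pose f k := Num.truncn (theta * k%:R).
have fP k : (f k)%:R <= theta * k%:R < (f k).+1%:R.
  by apply: truncn_itv; rewrite mulr_ge0.
pose J k := (f k.-1 < f k)%N.
have cJ M : count J (iota 0 M.+1) = f M.
  apply: count_jumps => [|k]; first by rewrite /f mulr0 truncn0.
  have /andP[h1 h2] := fP k; have /andP[h3 h4] := fP k.+1.
  have e : theta * k.+1%:R = theta * k%:R + theta by rewrite -natr1 mulrDr mulr1.
  rewrite e -!natr1 in h2 h3 h4; apply/andP; split; rewrite -ltnS -(ltr_nat R) -!natr1; lra.
(* [Lam_inj_eps] recovers only the bits at lengths [2] and above, so the bits are shifted by two to
   make [F] injective. *)
pose F (e : nat -> bool) := Lam (R := R) q1 q2 J (fun k => e k.-2).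
apply: (@uncountable_family _ _ F) => [e|e e' FE k]; last first.
  by have := @Lam_inj_eps R q1 q2 hq1 hq12 J _ _ _ FE k; apply; rewrite /J ltnn.
split.
  by apply: is_spectrum_lam => //; [exact: sig_mod|exact: sig_form].
apply: (@beurling_dim_counts R _ b (fun M => count J (iota 0 M)) t theta) => //.
- by move=> M; rewrite cJ; have /andP[] := fP M.
- by move=> M; rewrite cJ; have /andP[_] := fP M; rewrite -natr1; lra.
- by move=> M x h; exact: card_upper.
- by move=> M h; exact: card_lower.
Qed.
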